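(* Let $n_1,n_2,n_3$ be positive integers with $\sum_j\frac1{n_j}<1$ and let $\rho:G(n_1,n_2,n_3)\to\mathrm{PU}(2,1)$, $g_j\mapsto I_j$, be a representation satisfying the quadrangle conditions (Q1)–(Q4), with associated points $c_i,p_i$ and complex geodesics $C_i=\mathbb P_{\mathbb C}(p_i^\perp)\cap\overline{\mathbb H}{}^2_{\mathbb C}$, $i=1,2,3,4$, where representatives are chosen so that $\langle c_i,c_i\rangle=-1$, $\langle p_i,p_i\rangle=1$. Let $q_i\in V$ be such that $c_i,p_i,q_i$ is a positively oriented orthonormal basis of $V$. Then there are curves $c_i(\delta),p_i(\delta),q_i(\delta)$ in $V$, $\delta\in[0,1]$, $i=1,2,3,4$, depending continuously on $\delta$, such that: (a) $c_i(0)=c_i$, $p_i(0)=p_i$, $q_i(0)=q_i$; (b) for each $\delta$, the vectors $c_i(\delta),p_i(\delta),q_i(\delta)$ form a positively oriented orthonormal basis of $V$; (c) for all $i\ne j$ we have $\mathrm{ta}(p_i(\delta),p_j(\delta))>1$ for all $\delta$; (d) with $C_i(\delta):=\mathbb P_{\mathbb C}(p_i(\delta)^\perp)\cap\overline{\mathbb H}{}^2_{\mathbb C}$, for each $\delta$ the triangles of bisectors $\Delta(C_1(\delta),C_2(\delta),C_4(\delta))$ and $\Delta(C_3(\delta),C_4(\delta),C_2(\delta))$ are transversal and counterclockwise oriented; (e) $q_1(1)=q_2(1)=q_3(1)=q_4(1)$ (so the four bisector segments $B[C_1(1),C_2(1)]$, $B[C_2(1),C_3(1)]$, $B[C_3(1),C_4(1)]$,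 $B[C_4(1),C_1(1)]$ all have the same focus).
   Context: $V$ is a three-dimensional complex vector space with a Hermitian form of signature $-++$. $\mathbb H^2_{\mathbb C}\subset\mathbb P_{\mathbb C}(V)$ is the set of negative points, $\overline{\mathbb H}{}^2_{\mathbb C}$ its union with the set $\partial\mathbb H^2_{\mathbb C}$ of isotropic points. The same letter denotes a point and a representative. $\mathrm{ta}(p,q)=\frac{\langle p,q\rangle\langle q,p\rangle}{\langle p,p\rangle\langle q,q\rangle}$. Orthonormal bases $c,p,q$ satisfy $-\langle c,c\rangle=\langle p,p\rangle=\langle q,q\rangle=1$; positively oriented means that a fixed complex volume form on $V$, normalized to have absolute value $1$ on orthonormal bases, takes the value $1$ on $(c,p,q)$. Bisectors. A complex geodesic is a nonempty intersection of a projective line $\mathbb P_{\mathbb C}(p^\perp)$ ($p$ positive, its polar point) with $\mathbb H^2_{\mathbb C}$ (or its closure). Two are ultraparallel, $L_1\parallel L_2$, if disjoint in $\overline{\mathbb H}{}^2_{\mathbb C}$ (equivalently, the tance of polar points is $>1$). For a geodesic $\mathbb P_{\mathbb C}(W)\cap\mathbb H^2_{\mathbb C}$ ($W\subset V$ a real $2$-dimensional subspace on which the form is real of signature $-+$), with $f$ the polar point of the complex geodesic $\mathbb P_{\mathbb C}(W+iW)$ containing it, the bisector with this real spine and focus $f$ is $\mathbb P_{\mathbb C}(W+\mathbb Cf)$ intersected with $\mathbb H^2_{\mathbb C}$ (or its closure); it is foliated by the complex geodesics (slices) joining points of the spine to $f$. Ultraparallel $L_1,L_2$ are slices of a unique bisector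 $B(L_1,L_2)$ (its spine is the common perpendicular geodesic); the segment $B[L_1,L_2]$ is the union of the slices over the spine segment between $L_1$ and $L_2$, oriented from $L_1$ to $L_2$. $K^+(L_1,L_2)$ denotes the closed half-space of $\overline{\mathbb H}{}^2_{\mathbb C}$ bounded by the full bisector $B(L_1,L_2)$ into which $iv$ points, $v$ being the tangent vector to the spine oriented from $L_1$ to $L_2$; $K^-(L_1,L_2)$ is the other half-space. Angles. If two bisector segments share an end slice $C$, then at $c\in C$ each has tangent half-space $T_cC\oplus\mathbb R_{\ge0}w_k$ with $w_k$ a unit vector in the complex line orthogonal to $T_cC$; the oriented angle from the first to the second is $\theta\in[0,2\pi)$ with $w_2=e^{i\theta}w_1$. Two full bisectors with a common slice are transversal along it if they (extended to the absolute, as hypersurfaces of $\mathbb P_{\mathbb C}(V)$) are transversal at every point of the closed slice. Triangles. For pairwise ultraparallel $L_1,L_2,L_3$, the triangle $\Delta(L_1,L_2,L_3)=B[L_1,L_2]\cup B[L_2,L_3]\cup B[L_3,L_1]$ is transversal if the full bisectors of its sides are transversal along the common slices; it is counterclockwise oriented if at points of $L_1$ the oriented angle from $B[L_1,L_2]$ to $B[L_1,L_3]$ lies in $(0,\pi)$. Two counterclockwise oriented transversal triangles $\Delta(C_1,C_2,C_4)$, $\Delta(C_3,C_4,C_2)$ are transversally adjacent if the sector $K^+(C_1,C_2)\cap K^-(C_1,C_4)$ at $C_1$ contains a point of $C_3$ and the full bisectors of $B[C_1,C_2],B[C_2,C_3]$ are transversal along $C_2$ and those of $B[C_3,C_4],B[C_4,C_1]$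 along $C_4$. Representation. $G(n_1,n_2,n_3)=\langle g_1,g_2,g_3\mid g_j^{n_j}=1,\ g_3g_2g_1=1\rangle$; $I_j=\rho(g_j)$ is elliptic (it fixes a negative point) of order $n_j$, and $I_1,I_3$ are regular elliptic (three distinct eigenvalues). Let $c_j,p_j$ be orthogonal fixed points of $I_j$, $c_j$ negative and $p_j$ positive ($j=1,2,3$), $c_4:=I_1^{-1}c_2$, $p_4:=I_1^{-1}p_2$ (so, as points, $c_4=I_3c_2$ and $p_4=I_3p_2$). Quadrangle conditions. (Q1) $C_1\parallel C_2$, $C_3\parallel C_2$, $C_2\parallel C_4$ (hence also $C_1\parallel C_4$, $C_3\parallel C_4$). (Q2) $\Delta(C_1,C_2,C_4)$ and $\Delta(C_3,C_4,C_2)$ are transversal and counterclockwise oriented. (Q3) They are transversally adjacent. (Q4) The interior angle at $c_1$ (from $B[C_1,C_2]$ to $B[C_1,C_4]$) is $2\pi/n_1$; the interior angle at $c_3$ (from $B[C_3,C_4]$ to $B[C_3,C_2]$) is $2\pi/n_3$; the sum of the interior angle at $c_2$ (from $B[C_2,C_3]$ to $B[C_2,C_1]$) and the interior angle at $c_4$ (from $B[C_4,C_1]$ to $B[C_4,C_3]$) is $2\pi/n_2$. *)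

(* Defs.v *)
From HB Require Import structures.
From mathcomp Require Export all_boot all_order all_algebra.
From mathcomp Require Export complex.
From mathcomp Require Export all_classical all_reals all_analysis.
Export numFieldNormedType.Exports.
Import Order.TTheory GRing.Theory Num.Theory.

Set Implicit Arguments.
Unset Strict Implicit.
Unset Printing Implicit Defensive.

Local Open Scope classical_set_scope.
Local Open Scope ring_scope.

(* R[i] carries no topology by itself; its regular alias R[i]^o does. *)
Notation Cplx R := (R[i]^o).
Notation vec R := ('rV[Cplx R]_3).
Notation herm R := {hermitian (vec R) for false & (@Num.conj (R[i]^o))}.

(* V is C^3, written as row vectors, with an arbitrary Hermitian form h
   (linear in its first argument) of signature -++.  A subset of P(V) is
   represented by the set of all nonzero vectors representing its points.
   The order of R[i] compares complex numbers with equal imaginary parts, so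
   that z < 0 or 1 < z also says that z is real. *)

Section Defs.
Variable R : realType.
Variable h : herm R.

Implicit Types (x y z u v w f p q : vec R) (W S : set (vec R)).

Definition orthonormal x y z : Prop :=
  [/\ h x x = -1, h y y = 1 & h z z = 1] /\
  [/\ h x y = 0, h x z = 0 & h y z = 0].

Definition signature_mpp : Prop := exists x y z, orthonormal x y z.

(* Every complex volume form on C^3 is a multiple of the determinant. *)
Definition vol (k : Cplx R) x y z : Cplx R := k * \det (col_mx x (col_mx y z)).

Definition normalized_vol (k : Cplx R) : Prop :=
  forall x y z, orthonormal x y z -> `|vol k x y z| = 1.

Definition pos_orthonormal (k : Cplx R) x y z : Prop :=
  orthonormal x y z /\ vol k x y z = 1.

Definition ta p q : Cplx R := (h p q * h q p) / (h p p * h q q).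

Definition same_point x y : Prop := exists2 a : Cplx R, a != 0 & x = a *: y.

Definition closed_ball : set (vec R) := [set x | x != 0 /\ h x x <= 0].

(* C_p := P(p^\bot), intersected with the closed ball; p is its polar point. *)
Definition cgeod p : set (vec R) := closed_ball `&` [set x | h x p = 0].

Definition ultraparallel p q : Prop := cgeod p `&` cgeod q = set0.

(* The real planes W on which h is real of signature -+. *)
Definition real_spine W : Prop := exists x y,
  [/\ h x x = -1, h y y = 1, h x y = 0 &
      W = [set w | exists s t : R, w = s%:C%C *: x + t%:C%C *: y]].

(* f is the polar point of P(W + iW). *)
Definition spine_polar W f : Prop := 0 < h f f /\ forall w, W w -> h w f = 0.

(* The closed complex geodesic joining w to f. *)
Definition slice f w : set (vec R) :=
  closed_ball `&` [set x | exists a b : Cplx R, x = a *: w + b *: f].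

(* The geodesics with polar points p and q are the slices, over w1 and w2, of
   the bisector with real spine W and focus f.  As h w1 w2 < 0, the
   representatives w1 and w2 lie in the same half of the negative cone of W;
   hence the negative points of W between [w1] and [w2] are exactly the
   [(1 - t) w1 + t w2] with t in [0, 1], and w2 - w1 represents the tangent
   vector at [w1] of the spine, oriented towards [w2]. *)
Definition bisector_data p q W f w1 w2 : Prop :=
  [/\ real_spine W, spine_polar W f,
      [/\ W w1, W w2, h w1 w1 < 0, h w2 w2 < 0 & h w1 w2 < 0],
      cgeod p = slice f w1 & cgeod q = slice f w2].

Definition bisector_focus p q f : Prop :=
  exists W w1 w2, bisector_data p q W f w1 w2.

(* The hypersurface P(W + C f) of P(V), where W and f are the real spine and
   the focus of B(C_p, C_q). *)
Definition bisector p q : set (vec R) :=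
  [set x | x != 0 /\ exists W f w1 w2, bisector_data p q W f w1 w2 /\
     exists w, W w /\ exists a b : Cplx R, x = a *: w + b *: f].

Definition bisector_segment p q : set (vec R) :=
  [set x | exists W f w1 w2, bisector_data p q W f w1 w2 /\
     exists2 t : R, 0 <= t <= 1 &
       slice f ((1 - t)%:C%C *: w1 + t%:C%C *: w2) x].

(* The closed half-space bounded by B(C_p, C_q) into which c v points, where v
   is the tangent vector of the spine oriented from C_p to C_q. *)
Definition half_space (c : Cplx R) p q : set (vec R) :=
  [set x | closed_ball x /\ (bisector p q x \/
     exists W f w1 w2, bisector_data p q W f w1 w2 /\
       \forall e \near (0 : R)^'+,
         connected_component (closed_ball `\` bisector p q)
           (w1 + (e%:C%C * c) *: (w2 - w1)) x)].

Definition Kplus p q := half_space 'i%C p q.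
Definition Kminus p q := half_space (- 'i%C) p q.

(* T_[x] P(V) = Hom(C x, V / C x).  For the representative x, the tangent
   vector x |-> v + C x is represented by v; the vectors below are all the
   representatives of the vectors tangent to S at [x]. *)
Definition tangent S x v : Prop := exists g : R -> vec R,
  [/\ g 0 = x, \forall t \near (0 : R), S (g t) &
      (t^-1)%:C%C *: (g t - x) @[t --> (0 : R)^'] --> v].

Definition half_tangent S x v : Prop := exists g : R -> vec R,
  [/\ g 0 = x, \forall t \near (0 : R)^'+, S (g t) &
      (t^-1)%:C%C *: (g t - x) @[t --> (0 : R)^'+] --> v].

Definition transversal_along p S1 S2 : Prop := forall x, cgeod p x ->
  forall v, exists v1 v2, [/\ tangent S1 x v1, tangent S2 x v2 & v = v1 + v2].

(* At a negative point x of C_p, the Hermitian metric of T_[x] P(V) is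
   - h v w / h x x on representatives orthogonal to x, and the complex
   subspace p^\bot = T_x C_p + C x represents T_x C_p.  The last condition
   says that the tangent half-space of S at x is T_x C_p + R_{>=0} w. *)
Definition inward_normal p S x w : Prop :=
  [/\ h w w = - h x x, (forall u, h u p = 0 -> h w u = 0) &
      forall v, half_tangent S x v <->
        exists u (r : R), [/\ h u p = 0, 0 <= r & v = u + r%:C%C *: w]].

Definition oriented_angle p S1 S2 x (theta : R) : Prop :=
  0 <= theta < 2 * pi /\
  exists w1 w2, [/\ inward_normal p S1 x w1, inward_normal p S2 x w2 &
    w2 = (cos theta +i* sin theta)%C *: w1].

(* Below, the complex geodesics L_j are given by their polar points p_j. *)

Definition transversal_triangle p1 p2 p3 : Prop :=
  [/\ transversal_along p1 (bisector p3 p1) (bisector p1 p2),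
      transversal_along p2 (bisector p1 p2) (bisector p2 p3) &
      transversal_along p3 (bisector p2 p3) (bisector p3 p1)].

Definition ccw_triangle p1 p2 p3 : Prop :=
  forall x, cgeod p1 x -> h x x < 0 ->
  exists2 theta : R, 0 < theta < pi &
    oriented_angle p1 (bisector_segment p1 p2) (bisector_segment p1 p3) x theta.

Definition transversally_adjacent p1 p2 p3 p4 : Prop :=
  [/\ exists x, [/\ cgeod p3 x, Kplus p1 p2 x & Kminus p1 p4 x],
      transversal_along p2 (bisector p1 p2) (bisector p2 p3) &
      transversal_along p4 (bisector p3 p4) (bisector p4 p1)].

(* An element of PU(2,1) is given by a lift A to the unitary group of h, acting
   on row vectors by x |-> x *m A; hence products of lifts are read from left
   to right, and A represents the identity iff it is scalar. *)
Definition unitary (A : 'M[Cplx R]_3) : Prop :=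
  forall x y, h (x *m A) (y *m A) = h x y.

Definition fixes (A : 'M[Cplx R]_3) x : Prop :=
  exists a : Cplx R, x *m A = a *: x.

Definition elliptic (A : 'M[Cplx R]_3) : Prop :=
  exists2 x, h x x < 0 & fixes A x.

Definition regular_elliptic (A : 'M[Cplx R]_3) : Prop :=
  elliptic A /\ exists a b c : Cplx R,
    uniq [:: a; b; c] && all (eigenvalue A) [:: a; b; c].

Definition proj_order (A : 'M[Cplx R]_3) (n : nat) : Prop :=
  [/\ (0 < n)%N, is_scalar_mx (A ^+ n) &
      forall m, (0 < m < n)%N -> ~~ is_scalar_mx (A ^+ m)].

(* By the universal property of G(n1, n2, n3), a homomorphism to PU(2,1) is a
   triple of elements satisfying the defining relations. *)
Definition triangle_rep (n1 n2 n3 : nat) (A1 A2 A3 : 'M[Cplx R]_3) : Prop :=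
  [/\ [/\ unitary A1, unitary A2 & unitary A3],
      [/\ elliptic A1, elliptic A2 & elliptic A3],
      [/\ proj_order A1 n1, proj_order A2 n2 & proj_order A3 n3],
      is_scalar_mx (A1 *m A2 *m A3) &
      regular_elliptic A1 /\ regular_elliptic A3].

Definition i1 : 'I_4 := 0.
Definition i2 : 'I_4 := 1.
Definition i3 : 'I_4 := 2.
Definition i4 : 'I_4 := 3.

Definition Q1 (p : 'I_4 -> vec R) : Prop :=
  [/\ ultraparallel (p i1) (p i2), ultraparallel (p i3) (p i2) &
      ultraparallel (p i2) (p i4)].

Definition Q2 (p : 'I_4 -> vec R) : Prop :=
  (transversal_triangle (p i1) (p i2) (p i4) /\
   ccw_triangle (p i1) (p i2) (p i4)) /\
  (transversal_triangle (p i3) (p i4) (p i2) /\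
   ccw_triangle (p i3) (p i4) (p i2)).

Definition Q3 (p : 'I_4 -> vec R) : Prop :=
  transversally_adjacent (p i1) (p i2) (p i3) (p i4).

(* The interior angle at c_i, measured from B[C_i, C_j] to B[C_i, C_k]. *)
Definition interior_angle (c p : 'I_4 -> vec R) (i j k : 'I_4) (theta : R) :=
  oriented_angle (p i) (bisector_segment (p i) (p j))
    (bisector_segment (p i) (p k)) (c i) theta.

Definition Q4 (n1 n2 n3 : nat) (c p : 'I_4 -> vec R) : Prop :=
  [/\ interior_angle c p i1 i2 i4 (2 * pi / n1%:R),
      interior_angle c p i3 i4 i2 (2 * pi / n3%:R) &
      exists theta2 theta4 : R,
        [/\ interior_angle c p i2 i3 i1 theta2,
            interior_angle c p i4 i1 i3 theta4 &
            theta2 + theta4 = 2 * pi / n2%:R]].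

Definition quadrangle_conditions (n1 n2 n3 : nat) (c p : 'I_4 -> vec R) :=
  [/\ Q1 p, Q2 p, Q3 p & Q4 n1 n2 n3 c p].

End Defs.

(* Main.v *)
(** For unit positive vectors p, q with ta(p, q) > 1, put
    T(x) = <x,p><p,q><q,x>.  The bisector B(C_p, C_q) is the hypersurface
    Im T = 0, and its segment is the set T <= 0.  Linearizing T at points of
    C_p shows that, for a triangle with pairwise tances a = ta(p, q),
    b = ta(p, r), c = ta(q, r), transversality along C_p means
    (x - ab)^2 < ab (a - 1)(b - 1), where x + iy = <p,q><q,r><r,p>, and that
    the orientation is counterclockwise iff y < 0.  These conditions survive
    the scaling (a, b, x, y) |-> (sa, sb, sx, sy) with s >= 1 and c fixed.

    Keep p_2 and p_4 fixed, let f be the unit vector orthogonal to both, and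
    rotate p_1 and p_3 in their planes with f until they become orthogonal to
    f: this only rescales the products <p_i, p_2> and <p_i, p_4>, by a common
    real factor >= 1.  So both triangles stay transversal and counterclockwise;
    since then C_1 and C_3 lie strictly on opposite sides of B(C_2, C_4), they
    stay ultraparallel.  At the end all p_i are orthogonal to f, and the q_i
    can be moved to f because SU(1,1) is path connected. *)
Require Import Defs.
From mathcomp Require Import ring lra.
Import Order.TTheory GRing.Theory Num.Theory.

Set Implicit Arguments.
Unset Strict Implicit.
Unset Printing Implicit Defensive.

Local Open Scope classical_set_scope.
Local Open Scope ring_scope.

(** Tangency is defined by curves, so it has to be turned into algebra. A point u of C_p enters only
    through z = <u,q><q,p> and w = <u,r><r,p>: at u the tangent hyperplanes of the bisectors of pq
    and pr consist of the v with <v,p> in R z, respectively in R w, so transversality at u means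
    that z conj(w) is not real. Since u lies in the closed ball, b(b-1)|z|^2 + a(a-1)|w|^2 + 2 Re(z
    conj(w) g) <= 0 with g = x + iy - ab, and the vertex inequality says exactly that no point of
    C_p has z conj(w) real. Written as x^2 - ab < ab(2x - a - b), that inequality also explains the
    scaling: the left side is of degree 2 in s, the right side of degree 3. Its consequence a + b <
    2x makes the right side positive; it also gives |<p_i,f>| < 1 for i = 1, 3, which is what allows
    p_i to be rotated into the complement of f. *)

Local Notation re := complex.Re.
Local Notation im := complex.Im.

(** * Complex numbers through their real and imaginary parts *)

Section ComplexNumbers.
Variable R : realType.
Implicit Types (z w : Cplx R) (a b : R).

Definition sqn z : R := re z ^+ 2 + im z ^+ 2.

Lemma complex_eq z w : re z = re w -> im z = im w -> z = w.
Proof. by case: z w => [a b] [c d] /= -> ->. Qed.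

Lemma reD z w : re (z + w) = re z + re w. Proof. by case: z w => [a b] [c d]. Qed.
Lemma imD z w : im (z + w) = im z + im w. Proof. by case: z w => [a b] [c d]. Qed.
Lemma reN z : re (- z) = - re z. Proof. by case: z. Qed.
Lemma imN z : im (- z) = - im z. Proof. by case: z. Qed.
Lemma reM z w : re (z * w) = re z * re w - im z * im w.
Proof. by case: z w => [a b] [c d]. Qed.
Lemma imM z w : im (z * w) = re z * im w + im z * re w.
Proof. by case: z w => [a b] [c d]. Qed.
Lemma re_conj z : re z^* = re z. Proof. by case: z. Qed.
Lemma im_conj z : im z^* = - im z. Proof. by case: z. Qed.
Lemma re0 : re (0 : Cplx R) = 0. Proof. by []. Qed.
Lemma im0 : im (0 : Cplx R) = 0. Proof. by []. Qed.
Lemma re1 : re (1 : Cplx R) = 1. Proof. by []. Qed.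
Lemma im1 : im (1 : Cplx R) = 0. Proof. by []. Qed.
Lemma reC a : re (a%:C%C : Cplx R) = a. Proof. by []. Qed.
Lemma imC a : im (a%:C%C : Cplx R) = 0. Proof. by []. Qed.

(** These rules turn identities with conjugates into polynomial identities over [R], within reach of
    [ring] and [nra]. *)
Definition reimE := (reD, imD, reN, imN, reM, imM, re_conj, im_conj,
  re0, im0, re1, im1, reC, imC).

Lemma mulC_conj z : z * z^* = (sqn z)%:C%C.
Proof. by apply: complex_eq; rewrite !reimE /sqn; ring. Qed.

Lemma conjC_real a : (a%:C%C : Cplx R)^* = a%:C%C.
Proof. by apply: complex_eq; rewrite !reimE ?oppr0. Qed.

Lemma realCD a b : (a + b)%:C%C = a%:C%C + b%:C%C :> Cplx R.
Proof. by apply: complex_eq; rewrite !reimE ?addr0. Qed.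
Lemma realCN a : (- a)%:C%C = - a%:C%C :> Cplx R.
Proof. by apply: complex_eq; rewrite !reimE ?oppr0. Qed.
Lemma realCM a b : (a * b)%:C%C = a%:C%C * b%:C%C :> Cplx R.
Proof. by apply: complex_eq; rewrite !reimE; ring. Qed.
Lemma realCI a b : a%:C%C = b%:C%C :> Cplx R -> a = b.
Proof. by case. Qed.

Lemma realC_eq0 a : (a%:C%C == 0 :> Cplx R) = (a == 0).
Proof. by apply/eqP/eqP => [[]|->]. Qed.

Lemma sqn_ge0 z : 0 <= sqn z.
Proof. by rewrite addr_ge0 ?sqr_ge0. Qed.

Lemma sqn_eq0 z : (sqn z == 0) = (z == 0).
Proof.
apply/eqP/eqP => [|->]; last by rewrite /sqn !reimE; ring.
by rewrite /sqn => e; apply: complex_eq; rewrite !reimE; nra.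
Qed.

Lemma sqn_gt0 z : (0 < sqn z) = (z != 0).
Proof. by rewrite lt_def sqn_ge0 sqn_eq0 andbT. Qed.

Lemma sqnM z w : sqn (z * w) = sqn z * sqn w.
Proof. by rewrite /sqn !reimE; ring. Qed.
Lemma sqn_conj z : sqn z^* = sqn z.
Proof. by rewrite /sqn !reimE; ring. Qed.
Lemma sqnN z : sqn (- z) = sqn z.
Proof. by rewrite /sqn !reimE; ring. Qed.
Lemma sqn_real a : sqn a%:C%C = a ^+ 2.
Proof. by rewrite /sqn !reimE; ring. Qed.
Lemma sqn_norm1 z : `|z| = 1 -> sqn z = 1.
Proof.
by move=> e; apply: (@realCI _ 1); rewrite -mulC_conj -normCK e expr1n.
Qed.

Lemma cplx_lt0 z : (z < 0) = (im z == 0) && (re z < 0).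
Proof. by case: z => a b; rewrite ltcE /= eq_sym. Qed.
Lemma cplx_le0 z : (z <= 0) = (im z == 0) && (re z <= 0).
Proof. by case: z => a b; rewrite lecE /= eq_sym. Qed.
Lemma cplx_gt0 z : (0 < z) = (im z == 0) && (0 < re z).
Proof. by case: z => a b; rewrite ltcE /=. Qed.
Lemma cplx_gt1 z : (1 < z) = (im z == 0) && (1 < re z).
Proof. by case: z => a b; rewrite ltcE /=. Qed.

End ComplexNumbers.

(** * Hermitian forms of signature -++: expansions, frames, orthogonal complements *)

Section Form.
Variable R : realType.
Variable h : herm R.
Implicit Types (x y z u v w f p q : vec R) (a b : Cplx R).

Lemma hDl x y z : h (x + y) z = h x z + h y z. Proof. exact: linearDl. Qed.
Lemma hZl a x z : h (a *: x) z = a * h x z. Proof. exact: linearZl_LR. Qed.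
Lemma hC x y : h x y = (h y x)^*.
Proof. by rewrite (hermC h x y) expr0 mul1r. Qed.
Lemma hDr x y z : h z (x + y) = h z x + h z y.
Proof. by rewrite hC hDl rmorphD /= -!hC. Qed.
Lemma hZr a x z : h z (a *: x) = a^* * h z x.
Proof. by rewrite hC hZl rmorphM /= -hC. Qed.
Lemma hNl x z : h (- x) z = - h x z. Proof. by rewrite -scaleN1r hZl mulN1r. Qed.
Lemma hNr x z : h z (- x) = - h z x. Proof. by rewrite hC hNl rmorphN /= -hC. Qed.
Lemma h0l z : h 0 z = 0. Proof. by rewrite -(scale0r z) hZl mul0r. Qed.
Lemma h0r z : h z 0 = 0. Proof. by rewrite hC h0l conjC0. Qed.

Definition hE := (hDl, hDr, hNl, hNr, hZl, hZr).

(** Taking the real part loses nothing, by [hxx], and puts norms into an ordered field. *)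
Definition hnorm x : R := re (h x x).
Local Notation nrm := hnorm.

Lemma h_im x : im (h x x) = 0.
Proof.
have /(congr1 (@complex.Im R)) := hC x x; rewrite im_conj => e; lra.
Qed.

Lemma hxx x : h x x = (nrm x)%:C%C.
Proof. by apply: complex_eq; rewrite !reimE // h_im. Qed.

Lemma hxx_lt0 x : (h x x < 0) = (nrm x < 0).
Proof. by rewrite cplx_lt0 h_im eqxx. Qed.
Lemma hxx_le0 x : (h x x <= 0) = (nrm x <= 0).
Proof. by rewrite cplx_le0 h_im eqxx. Qed.
Lemma hxx_gt0 x : (0 < h x x) = (0 < nrm x).
Proof. by rewrite cplx_gt0 h_im eqxx. Qed.

Lemma nrmZ a x : nrm (a *: x) = sqn a * nrm x.
Proof. by rewrite /nrm !hE hxx !reimE /sqn; ring. Qed.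

Lemma nrm0 : nrm 0 = 0. Proof. by rewrite /nrm h0l. Qed.

Lemma nrm_neq0 x : nrm x != 0 -> x != 0.
Proof. by apply: contra => /eqP ->; rewrite nrm0. Qed.

Lemma nrmD x y : nrm (x + y) = nrm x + nrm y + 2 * re (h x y).
Proof. by rewrite /nrm !hE !reimE (hC y x) re_conj; ring. Qed.

Lemma h_eq0C x y : h x y = 0 -> h y x = 0.
Proof. by rewrite hC => e; rewrite -(conjCK (h y x)) e conjC0. Qed.

(* A linear dependence between the rows is killed by pairing it with each row. *)
Lemma orthogonal_expand x y z v :
  nrm x != 0 -> nrm y != 0 -> nrm z != 0 ->
  h x y = 0 -> h x z = 0 -> h y z = 0 ->
  v = (h v x / h x x) *: x + (h v y / h y y) *: y + (h v z / h z z) *: z.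
Proof.
move=> nx ny nz xy xz yz.
have yx := h_eq0C xy; have zx := h_eq0C xz; have zy := h_eq0C yz.
have Nx : h x x != 0 by rewrite hxx realC_eq0.
have Ny : h y y != 0 by rewrite hxx realC_eq0.
have Nz : h z z != 0 by rewrite hxx realC_eq0.
(* The size 1 + (1 + 1) is 3 by conversion and makes the block-matrix lemmas apply. *)
pose M : 'M[Cplx R]_(1 + (1 + 1)) := col_mx x (col_mx y z).
have ME (r : 'rV[Cplx R]_(1 + (1 + 1))) :
    exists a b c : Cplx R, r *m M = a *: x + b *: y + c *: z /\
      (a = 0 -> b = 0 -> c = 0 -> r = 0).
  exists (lsubmx r 0 0), (lsubmx (rsubmx r) 0 0), (rsubmx (rsubmx r) 0 0).
  split=> [|e1 e2 e3].
    rewrite /M -[in LHS](hsubmxK r) mul_row_col.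
    rewrite -[X in _ + X *m _](hsubmxK (rsubmx r)) mul_row_col.
    rewrite -!mul_scalar_mx -!mx11_scalar addrA.
    by [].
  rewrite -(hsubmxK r) -(hsubmxK (rsubmx r)).
  rewrite (mx11_scalar (lsubmx r)) (mx11_scalar (lsubmx (rsubmx r))).
  rewrite (mx11_scalar (rsubmx (rsubmx r))) e1 e2 e3.
  by rewrite -scalemx1 scale0r !row_mx0.
have coef a b c w : w = a *: x + b *: y + c *: z ->
    [/\ a = h w x / h x x, b = h w y / h y y & c = h w z / h z z].
  by move=> ->; rewrite !hE xy xz yz yx zx zy; split; field.
have Mu : M \in unitmx.
  rewrite -row_free_unit; apply: inj_row_free => r r0.
  have [a [b [c [e]]]] := ME r; rewrite r0 in e.
  have [-> -> ->] := coef _ _ _ _ e.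
  by rewrite !h0l !mul0r => ->.
have [a [b [c [e _]]]] := ME (v *m invmx M).
by have := e; rewrite mulmxKV // => {}e; have [<- <- <-] := coef _ _ _ _ e.
Qed.

Lemma orthonormal_nrm c p q : orthonormal h c p q ->
  [/\ nrm c = -1, nrm p = 1 & nrm q = 1].
Proof. by case=> -[cc pp qq] _; rewrite /nrm cc pp qq reN. Qed.

Lemma orthonormal_expand c p q v : orthonormal h c p q ->
  v = (- h v c) *: c + h v p *: p + h v q *: q.
Proof.
move=> o; have [nc np nq] := orthonormal_nrm o.
case: o => -[cc pp qq] [cp cq pq].
have [c0 p0 q0] : [/\ nrm c != 0, nrm p != 0 & nrm q != 0].
  by rewrite nc np nq oppr_eq0 oner_eq0.
have := orthogonal_expand v c0 p0 q0 cp cq pq.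
by rewrite cc pp qq !divr1 invrN1 mulrN1.
Qed.

Lemma orthonormal_h c p q v w : orthonormal h c p q ->
  h v w = - (h v c * h c w) + h v p * h p w + h v q * h q w.
Proof.
by move=> o; rewrite {1}(orthonormal_expand v o) !hE; ring.
Qed.

Lemma orthonormal_nrmE c p q v : orthonormal h c p q ->
  nrm v = - sqn (h v c) + sqn (h v p) + sqn (h v q).
Proof.
move=> o; rewrite {1}/nrm (orthonormal_h v v o) (hC c v) (hC p v) (hC q v).
by rewrite !mulC_conj !reimE.
Qed.

Lemma nrm_unit x (a : R) : 0 < a -> nrm x = a ->
  nrm ((Num.sqrt a)^-1%:C%C *: x) = 1.
Proof.
move=> a0 e; rewrite nrmZ sqn_real e exprVn sqr_sqrtr ?ltW //.
by rewrite mulVf ?gt_eqF.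
Qed.

Lemma nrm_negunit x (a : R) : 0 < a -> nrm x = - a ->
  nrm ((Num.sqrt a)^-1%:C%C *: x) = -1.
Proof.
move=> a0 e; rewrite nrmZ sqn_real e exprVn sqr_sqrtr ?ltW //.
by rewrite mulrN mulVf ?gt_eqF.
Qed.

Lemma nrm_unit_h x : nrm x = 1 -> h x x = 1.
Proof. by rewrite hxx => ->. Qed.

Hypothesis hsig : signature_mpp h.

(** Reversed Cauchy-Schwarz: orthogonality bounds |y_0|^2 |m_0|^2 by (|y_1|^2 + |y_2|^2)(|m_1|^2 +
    |m_2|^2), by Lagrange's identity, and negativity of n says that |m_0|^2 exceeds the last
    factor. *)
Lemma orth_neg_gt0 n y : nrm n < 0 -> h y n = 0 -> y != 0 -> 0 < nrm y.
Proof.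
move=> nn yn y0; have [e0 [e1 [e2 o]]] := hsig.
have yE := orthonormal_nrmE y o; have nE := orthonormal_nrmE n o.
have := orthonormal_h y n o; rewrite yn (hC e0 n) (hC e1 n) (hC e2 n).
have ynz : ~ (h y e0 = 0 /\ h y e1 = 0 /\ h y e2 = 0).
  move=> [y_0 [y_1 y_2]]; move/eqP: y0; apply.
  by rewrite (orthonormal_expand y o) y_0 y_1 y_2 oppr0 !scale0r !addr0.
rewrite yE; move: nn; rewrite nE.
move: (h y e0) (h y e1) (h y e2) (h n e0) (h n e1) (h n e2) ynz => {yE nE yn y0}.
move=> y_0 y_1 y_2 m0 m1 m2 ynz nn e.
have {}e : y_0 * m0^* = y_1 * m1^* + y_2 * m2^*.
  by rewrite -[LHS]addr0 e; ring.
have cs : sqn y_0 * sqn m0 <= (sqn y_1 + sqn y_2) * (sqn m1 + sqn m2).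
  rewrite -(sqn_conj m0) -sqnM e.
  have -> : (sqn y_1 + sqn y_2) * (sqn m1 + sqn m2) =
      sqn (y_1 * m1^* + y_2 * m2^*) + sqn (y_1 * m2 - y_2 * m1).
    by rewrite /sqn !reimE; ring.
  by rewrite lerDl sqn_ge0.
have [Y0|Y0] := eqVneq (sqn y_1 + sqn y_2) 0.
  have m0_gt0 : 0 < sqn m0 by have := sqn_ge0 m1; have := sqn_ge0 m2; lra.
  have y00 : sqn y_0 = 0.
    apply/eqP; rewrite eq_le sqn_ge0 andbT -(pmulr_lle0 _ m0_gt0) (le_trans cs) //.
    by rewrite Y0 mul0r.
  case: ynz; have g1 := sqn_ge0 y_1; have g2 := sqn_ge0 y_2.
  by split; [|split]; apply/eqP; rewrite -sqn_eq0; apply/eqP; lra.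
have Yp : 0 < sqn y_1 + sqn y_2 by rewrite lt_def Y0 addr_ge0 ?sqn_ge0.
have m0p : 0 < sqn m0 by have := sqn_ge0 m1; have := sqn_ge0 m2; lra.
suff : sqn y_0 * sqn m0 < (sqn y_1 + sqn y_2) * sqn m0.
  by rewrite ltr_pM2r // => ?; lra.
by apply: le_lt_trans cs _; rewrite ltr_pM2l //; lra.
Qed.

Lemma orth_neg_ge0 n y : nrm n < 0 -> h y n = 0 -> 0 <= nrm y.
Proof.
move=> nn yn; have [->|y0] := eqVneq y 0; first by rewrite nrm0.
exact/ltW/(orth_neg_gt0 nn yn).
Qed.

Lemma orth_neg_cauchy n y z : nrm n < 0 -> h y n = 0 -> h z n = 0 ->
  sqn (h y z) <= nrm y * nrm z.
Proof.
move=> nn yn zn; have [->|z0] := eqVneq z 0.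
  by rewrite h0r nrm0 mulr0 /sqn !reimE; lra.
have zp := orth_neg_gt0 nn zn z0.
have : 0 <= nrm ((nrm z)%:C%C *: y - h y z *: z).
  by apply: (orth_neg_ge0 nn); rewrite !hE yn zn !mulr0 oppr0 addr0.
have -> : nrm ((nrm z)%:C%C *: y - h y z *: z) =
    nrm z * (nrm y * nrm z - sqn (h y z)).
  rewrite {1}/nrm !hE !hxx (hC z y) conjC_real /sqn !reimE.
  by ring.
by rewrite pmulr_rge0 // subr_ge0.
Qed.

(** Projecting [e0] off p gives [c]; the vector of span(e1, e2) orthogonal to p is orthogonal to
    [e0] too, hence to [c]. Both have norm 1 + |<e0,p>|^2 up to sign, so normalizing never fails. *)
Lemma extend_frame p : nrm p = 1 -> exists c q, orthonormal h c p q.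
Proof.
move=> np; have pp := nrm_unit_h np; have [e0 [e1 [e2 o]]] := hsig.
have [[e00 e11 e22] [e01 e02 e12]] := o.
have e10 := h_eq0C e01; have e20 := h_eq0C e02; have e21 := h_eq0C e12.
pose c := e0 - h e0 p *: p.
pose q := h e2 p *: e1 - h e1 p *: e2.
have nc : nrm c = - (1 + sqn (h e0 p)).
  rewrite /nrm /c !hE e00 pp (hC p e0) /sqn !reimE; ring.
have nq : nrm q = 1 + sqn (h e0 p).
  have := orthonormal_nrmE p o; rewrite np (hC p e0) (hC p e1) (hC p e2) !sqn_conj.
  have -> : nrm q = sqn (h e1 p) + sqn (h e2 p).
    by rewrite /nrm /q !hE e11 e22 e12 e21 /sqn !reimE; ring.
  lra.
have a0 : 0 < 1 + sqn (h e0 p) by have := sqn_ge0 (h e0 p); lra.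
have cp : h c p = 0 by rewrite /c !hE pp; ring.
have qp : h q p = 0 by rewrite /q !hE; ring.
have qc : h q c = 0.
  by rewrite /c hDr hNr hZr qp /q !hE e10 e20; ring.
exists ((Num.sqrt (1 + sqn (h e0 p)))^-1%:C%C *: c).
exists ((Num.sqrt (1 + sqn (h e0 p)))^-1%:C%C *: q).
split; first by rewrite !hxx nrm_negunit // nrm_unit // np realCN.
by rewrite !hZl !hZr cp (h_eq0C qc) (h_eq0C qp) !mulr0.
Qed.

(* In the plane p^\bot with orthonormal basis c, q, the vector orthogonal to v. *)
Lemma orth_complement c p q v : orthonormal h c p q ->
  let f := h q v *: c - h c v *: q in
  [/\ h f p = 0, h f v = 0, nrm f = sqn (h v p) - nrm v &
      f = 0 -> h c v = 0].
Proof.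
move=> o f; have [[cc pp qq] [cp cq pq]] := o; have qc := h_eq0C cq.
split; rewrite /f.
- by rewrite !hE cp (h_eq0C pq) !mulr0 oppr0 addr0.
- by rewrite !hE; ring.
- rewrite (orthonormal_nrmE v o) /nrm !hE cc qq cq qc (hC v c) (hC v q) /sqn !reimE.
  ring.
- move/(congr1 (h^~ q)); rewrite h0l !hE cq qq mulr0 mulr1 add0r.
  by move/eqP; rewrite oppr_eq0 => /eqP.
Qed.

End Form.

Arguments hC {R h} x y.
Arguments orthogonal_expand {R h} [x y z] v _ _ _ _ _ _.

(** * Equations of bisectors and of their segments *)

Section Bisectors.
Variable R : realType.
Variable h : herm R.
Hypothesis hsig : signature_mpp h.
Local Notation nrm := (hnorm h).
Implicit Types (x y z u v w f p q : vec R) (a b : Cplx R).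

Definition tance p q : R := sqn (h p q).
Local Notation tau := tance.

Lemma tauC p q : tau p q = tau q p.
Proof. by rewrite /tau hC sqn_conj. Qed.

Lemma h_mul_tau p q : h p q * h q p = (tau p q)%:C%C.
Proof. by rewrite (hC q p) mulC_conj. Qed.

(** The vector orthogonal to p and q supplied by [orth_complement] has norm ta(p, q) - 1, so for
    ta(p, q) <= 1 it is a common point. If it vanishes, [c] is orthogonal to q and serves
    instead. *)
Lemma disjoint_tau_gt1 p q : nrm p = 1 -> nrm q = 1 ->
  ultraparallel h p q -> 1 < tau p q.
Proof.
move=> np nq pq; have [c [r o]] := extend_frame hsig np.
have [nc _ nr] := orthonormal_nrm o.
have [fp fq nf f0] := orth_complement q o.
rewrite ltNge; apply/negP => t1; rewrite nq -/(tau _ _) tauC in nf.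
have : (cgeod h p `&` cgeod h q) !=set0; last by rewrite pq => -[].
case: o => [_ [cp _ _]].
have [/f0 cq|n0] := eqVneq (h r q *: c - h c q *: r) 0.
  exists c; split; (split; [split|]) => //; rewrite ?hxx_le0 ?nc ?lerN10 //.
    by apply: nrm_neq0 (h) _ _; rewrite nc oppr_eq0 oner_eq0.
  by apply: nrm_neq0 (h) _ _; rewrite nc oppr_eq0 oner_eq0.
exists (h r q *: c - h c q *: r); split; (split; [split|]) => //;
  by rewrite hxx_le0 nf subr_le0.
Qed.

Lemma common_polar p q : nrm p = 1 -> nrm q = 1 -> 1 < tau p q ->
  exists f, [/\ nrm f = 1, h f p = 0 & h f q = 0].
Proof.
move=> np nq pq; have [c [r o]] := extend_frame hsig np.
have [fp fq nf _] := orth_complement q o.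
have t0 : 0 < tau p q - 1 by lra.
exists ((Num.sqrt (tau p q - 1))^-1%:C%C *: (h r q *: c - h c q *: r)).
by rewrite (nrm_unit t0) ?nf ?nq -/(tau _ _) 1?tauC // !hZl fp fq !mulr0.
Qed.

Lemma slice_polar f w p : 0 < nrm f -> nrm w < 0 -> slice h f w `<=` cgeod h p ->
  h w f = 0 -> h w p = 0 /\ h f p = 0.
Proof.
move=> nf nw sub wf.
have wp : h w p = 0.
  have [] // : cgeod h p w.
  apply: sub; split; last by exists 1, 0; rewrite scale1r scale0r addr0.
  split; last by rewrite hxx_le0 ltW.
  by apply: nrm_neq0 (h) _ _; rewrite lt_eqF.
split=> //.
(* With this factor w + e f is isotropic, hence in the closed slice; being orthogonal to p, like w,
   it forces <f,p> = 0. *)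
pose e := Num.sqrt (- nrm w / nrm f).
have e0 : 0 < e by rewrite sqrtr_gt0 divr_gt0 // oppr_gt0.
have [] : cgeod h p (1 *: w + e%:C%C *: f); last first.
  move=> _ /=; rewrite hDl !hZl wp mulr0 add0r => /eqP.
  by rewrite mulf_eq0 realC_eq0 gt_eqF //= => /eqP.
apply: sub; split; last by exists 1, e%:C%C.
split.
  apply/eqP => /(congr1 (h^~ w)); rewrite h0l hDl !hZl (h_eq0C wf) mulr0 addr0.
  by rewrite mul1r hxx => /eqP; rewrite realC_eq0 lt_eqF.
rewrite hxx_le0 scale1r nrmD nrmZ sqn_real hZr wf mulr0 reimE.
rewrite sqr_sqrtr; last by rewrite divr_ge0 ?oppr_ge0 ?ltW.
by rewrite divfK ?gt_eqF //; lra.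
Qed.

(** The function T of the overview. Rescaling x multiplies it by a positive real, so the sign of its
    imaginary part and the condition T <= 0 depend only on the point. *)
Definition bform p q x : Cplx R := h x p * h p q * h q x.

Lemma bformC p q x : bform q p x = (bform p q x)^*.
Proof. by rewrite /bform !rmorphM /= -!hC; ring. Qed.

(* In coordinates (a, b, c) relative to w1, w2 and f, the function bform p q is a
   negative multiple of b a^*. *)
Lemma bisector_dataP p q W f w1 w2 : nrm p = 1 -> nrm q = 1 -> 1 < tau p q ->
  bisector_data h p q W f w1 w2 -> exists2 K : R, K < 0 &
  [/\ forall a b c, bform p q (a *: w1 + b *: w2 + c *: f) = b * a^* * K%:C%C,
      forall x, exists a b c, x = a *: w1 + b *: w2 + c *: f &
      W = [set w | exists s t : R, w = s%:C%C *: w1 + t%:C%C *: w2]].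
Proof.
move=> np nq pq [[x [y [xx yy xy We]]] [f_gt0 Wf] [Ww1 Ww2 w1n w2n w12] c1 c2].
rewrite hxx_gt0 in f_gt0; rewrite !hxx_lt0 in w1n w2n.
have w1f := Wf _ Ww1; have w2f := Wf _ Ww2.
have [w1p fp] : h w1 p = 0 /\ h f p = 0 by apply: slice_polar; rewrite -?c1.
have [w2q fq] : h w2 q = 0 /\ h f q = 0 by apply: slice_polar; rewrite -?c2.
have [n1 n2 nf] : [/\ nrm w1 != 0, nrm w2 != 0 & nrm f != 0].
  by rewrite !(lt_eqF w1n, lt_eqF w2n, gt_eqF f_gt0).
have [s1 [t1 e1]] : exists s t : R, w1 = s%:C%C *: x + t%:C%C *: y.
  by move: Ww1; rewrite We.
have [s2 [t2 e2]] : exists s t : R, w2 = s%:C%C *: x + t%:C%C *: y.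
  by move: Ww2; rewrite We.
have yx := h_eq0C xy.
have N1 : nrm w1 = - s1 ^+ 2 + t1 ^+ 2.
  by rewrite /nrm e1 !hE xx yy xy yx !conjC_real !reimE; ring.
have N2 : nrm w2 = - s2 ^+ 2 + t2 ^+ 2.
  by rewrite /nrm e2 !hE xx yy xy yx !conjC_real !reimE; ring.
pose m := - s1 * s2 + t1 * t2.
have M12 : h w1 w2 = m%:C%C.
  rewrite e1 e2 !hE xx yy xy yx !conjC_real /m realCD !realCM realCN; ring.
have M21 : h w2 w1 = m%:C%C by rewrite hC M12 conjC_real.
have m0 : m < 0 by move: w12; rewrite M12 cplx_lt0 /= => /andP[].
pose D := s1 * t2 - s2 * t1.
have DE : m ^+ 2 - nrm w1 * nrm w2 = D ^+ 2 by rewrite N1 N2 /m /D; ring.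
have pp := nrm_unit_h np; have qq := nrm_unit_h nq.
have p0 : nrm p != 0 by rewrite np oner_eq0.
have q0 : nrm q != 0 by rewrite nq oner_eq0.
(* If w1 and w2 were proportional, q would be orthogonal to both w1 and f, hence a multiple of p,
   and the tance would be 1. *)
have D0 : D != 0.
  apply/eqP => D0; have s20 : s2 != 0.
    by apply/eqP => s20; move: w2n; rewrite N2 s20; nra.
  have e : s1%:C%C *: w2 = s2%:C%C *: w1.
    rewrite e1 e2 !scalerDr !scalerA -!realCM (mulrC s1 s2).
    by congr (_ + _%:C%C *: _); move: D0; rewrite /D; lra.
  have w1q : h w1 q = 0.
    have /eqP : s2%:C%C * h w1 q = 0 by rewrite -hZl -e hZl w2q mulr0.
    by rewrite mulf_eq0 realC_eq0 (negbTE s20) => /eqP.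
  have := orthogonal_expand q n1 p0 nf w1p w1f (h_eq0C fp).
  rewrite (h_eq0C w1q) (h_eq0C fq) !mul0r !scale0r addr0 add0r pp divr1.
  by move=> /(congr1 nrm); rewrite nrmZ np nq mulr1 -/(tau q p) tauC => ?; lra.
pose u := h w2 p; pose v := h w1 q.
have N1' : h w1 w1 != 0 by rewrite hxx realC_eq0.
have N2' : h w2 w2 != 0 by rewrite hxx realC_eq0.
(* In the complement of f, p spans the orthogonal of w1 and q that of w2. This expresses u p and v q
   through w1 and w2, and gives the constant K = u <p,q> conj(v), negative because <w1,w2> is. *)
have up : u *: p = w2 - (m / nrm w1)%:C%C *: w1.
  have := orthogonal_expand w2 n1 p0 nf w1p w1f (h_eq0C fp).
  rewrite w2f mul0r scale0r addr0 pp divr1 M21 hxx -fmorph_div /= => ->.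
  by rewrite addrC addKr.
have vq : v *: q = w1 - (m / nrm w2)%:C%C *: w2.
  have := orthogonal_expand w1 n2 q0 nf w2q w2f (h_eq0C fq).
  rewrite w1f mul0r scale0r addr0 qq divr1 M12 hxx -fmorph_div /= => ->.
  by rewrite addrC addKr.
have u0 : u != 0.
  apply/eqP => u0; move: up; rewrite u0 scale0r => /esym/(congr1 (h w2)).
  rewrite h0r !hE M21 hxx conjC_real -realCM -realCN -realCD => /realCI.
  move/(congr1 (fun r => r * nrm w1)); rewrite mul0r.
  have -> : (nrm w2 - m / nrm w1 * m) * nrm w1 = - (m ^+ 2 - nrm w1 * nrm w2).
    by field.
  by rewrite DE => /eqP; rewrite oppr_eq0 sqrf_eq0 (negbTE D0).
pose K := m * D ^+ 2 / (nrm w1 * nrm w2).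
have KE : u * h p q * v^* = K%:C%C.
  have -> : u * h p q * v^* = h (u *: p) (v *: q) by rewrite hZl hZr; ring.
  rewrite up vq !hE M12 M21 !hxx !conjC_real.
  rewrite -!(realCM, realCD, realCN); congr (_%:C)%C.
  by rewrite /K -DE; field; rewrite n1 n2.
exists K.
  by rewrite /K pmulr_llt0 ?invr_gt0 ?nmulr_rgt0 // nmulr_rlt0 // exprn_even_gt0.
split.
- move=> a b c; rewrite /bform !hDl !hZl !hDr !hZr w1p fp -/u.
  rewrite (hC q w1) (hC q w2) (hC q f) w2q fq -/v -KE conjC0; ring.
- move=> z; exists (h z w1 / h w1 w1 - h z p / u * (m / nrm w1)%:C%C).
  exists (h z p / u), (h z f / h f f).
  rewrite {1}(orthogonal_expand z n1 p0 nf w1p w1f (h_eq0C fp)) pp divr1.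
  congr (_ + _).
  have -> : p = u^-1 *: (w2 - (m / nrm w1)%:C%C *: w1).
    by rewrite -up scalerA mulVf ?scale1r.
  rewrite scalerBl !scalerBr !scalerA addrAC addrA.
  by congr (_ - _); rewrite -!scalerA.
- rewrite We; apply/seteqP; split => w /= [s [t ->]].
    exists ((s * t2 - t * s2) / D), ((s1 * t - t1 * s) / D).
    rewrite e1 e2 !scalerDr !scalerA addrACA -!scalerDl -!realCM -!realCD.
    by congr (_%:C%C *: _ + _%:C%C *: _); rewrite /D in D0 *; field.
  exists (s * s1 + t * s2), (s * t1 + t * t2).
  by rewrite e1 e2 !scalerDr !scalerA addrACA -!scalerDl -!realCM -!realCD.
Qed.

Lemma bisector_data_exists p q f : nrm p = 1 -> nrm q = 1 -> 1 < tau p q ->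
  0 < nrm f -> h f p = 0 -> h f q = 0 ->
  exists W w1 w2, bisector_data h p q W f w1 w2.
Proof.
move=> np nq pq nf fp fq.
have pp := nrm_unit_h np; have qq := nrm_unit_h nq.
have pf := h_eq0C fp; have qf := h_eq0C fq.
pose t := tau p q; pose g := h p q; pose r := Num.sqrt (t ^+ 2 - t).
have gg : g * g^* = t%:C%C by rewrite mulC_conj.
have gpq : h (g *: q) p = t%:C%C by rewrite hZl h_mul_tau.
have gqq : h (g *: q) (g *: q) = t%:C%C by rewrite !hE qq mulr1.
have gpq' : h p (g *: q) = t%:C%C by rewrite hC gpq conjC_real.
(* Here g q is the multiple of q whose product with p is real. Subtracting multiples of p makes w1
   orthogonal to p and w2 orthogonal to q; both multiples are real, so the real span of w1 and p
   contains w2. *)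
pose w1 := g *: q - t%:C%C *: p; pose w2 := g *: q - p.
have tt : 0 < t ^+ 2 - t by rewrite /t; nra.
have r0 : 0 < r by rewrite sqrtr_gt0.
have rr : r ^+ 2 = t ^+ 2 - t by rewrite sqr_sqrtr ?ltW.
have w1p : h w1 p = 0 by rewrite /w1 hDl hNl gpq hZl pp mulr1 subrr.
have w2q : h w2 q = 0 by rewrite /w2 hDl hNl hZl qq mulr1 subrr.
have w1f : h w1 f = 0 by rewrite /w1 !hE pf qf !mulr0 oppr0 addr0.
have w2f : h w2 f = 0 by rewrite /w2 !hE pf qf !mulr0 oppr0 addr0.
have w12 : w2 = w1 + (t - 1)%:C%C *: p.
  rewrite /w2 /w1 realCD realCN scalerDl scaleNr scale1r addrA.
  by rewrite -[in RHS](addrA _ _ (t%:C%C *: p)) addNr addr0.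
have w11 : h w1 w1 = (- r ^+ 2)%:C%C.
  have w1r y : h y w1 = h y (g *: q) - t%:C%C * h y p.
    by rewrite /w1 hDr hNr [h y (t%:C%C *: p)]hZr conjC_real.
  rewrite w1r w1p mulr0 subr0 /w1 hDl hNl gqq hZl gpq'.
  by rewrite -realCM -realCN -realCD rr; congr (_%:C)%C; ring.
have w22 : h w2 w2 = (1 - t)%:C%C.
  rewrite w12; move: (w1) w11 w1p => w ww wp.
  rewrite !hE wp (h_eq0C wp) ww pp conjC_real.
  rewrite !(mulr0, mulr1, addr0, add0r) -realCM -realCD rr; congr (_%:C)%C; ring.
clearbody w1 w2.
exists [set w | exists s t : R, w = s%:C%C *: (r^-1%:C%C *: w1) + t%:C%C *: p].
exists w1, w2; split.
- exists (r^-1%:C%C *: w1), p; split=> //; last by rewrite hZl w1p mulr0.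
  rewrite !hE w11 conjC_real -!realCM -[-1]realCN; congr (_%:C)%C.
  by field; rewrite gt_eqF.
- split; first by rewrite hxx_gt0.
  by move=> w [s [u ->]]; rewrite hDl !hZl w1f pf !mulr0 addr0.
- have rw : r%:C%C *: (r^-1%:C%C *: w1) = w1.
    by rewrite scalerA -realCM mulfV ?gt_eqF // scale1r.
  split.
  + by exists r, 0; rewrite rw scale0r addr0.
  + by exists r, (t - 1); rewrite rw.
  + by rewrite w11 cplx_lt0 eqxx /= oppr_lt0 exprn_gt0.
  + by rewrite w22 cplx_lt0 eqxx /= subr_lt0.
  + rewrite w12 hDr hZr w1p mulr0 addr0 w11 cplx_lt0 eqxx /= oppr_lt0.
    exact: exprn_gt0.
- have nw1 : nrm w1 != 0 by rewrite /nrm w11 /= oppr_eq0 sqrf_eq0 gt_eqF.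
  apply/seteqP; split=> x [cx] /=; last first.
    by move=> [a [b xE]]; split=> //; rewrite /= xE hDl !hZl w1p fp !mulr0 addr0.
  move=> xp; split=> //; exists (h x w1 / h w1 w1), (h x f / h f f).
  rewrite {1}(@orthogonal_expand _ h w1 p f x nw1) ?np ?oner_eq0 ?gt_eqF //.
  by rewrite xp mul0r scale0r addr0.
- have nw2 : nrm w2 != 0 by rewrite /nrm w22 /= subr_eq0 lt_eqF.
  apply/seteqP; split=> x [cx] /=; last first.
    by move=> [a [b xE]]; split=> //; rewrite /= xE hDl !hZl w2q fq !mulr0 addr0.
  move=> xq; split=> //; exists (h x w2 / h w2 w2), (h x f / h f f).
  rewrite {1}(@orthogonal_expand _ h w2 q f x nw2) ?nq ?oner_eq0 ?gt_eqF //.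
  by rewrite xq mul0r scale0r addr0.
Qed.

Lemma real_ratio a b : a != 0 -> im (b * a^*) = 0 ->
  b = (re (b * a^*) / sqn a)%:C%C * a.
Proof.
rewrite -sqn_eq0; case: a b => a1 a2 [b1 b2] sa; rewrite /sqn !reimE /= in sa *.
move=> e; have e1 := congr1 ( *%R a1) e; have e2 := congr1 ( *%R a2) e.
apply: complex_eq; rewrite !reimE /= mul0r ?subr0 ?addr0; apply: (mulIf sa);
  rewrite mulrAC divfK //; lra.
Qed.

(** In the coordinates of [bisector_dataP] the equation says that b conj(a) is real, that is, a w1 +
    b w2 is a complex multiple of a vector of W. As W and f do not occur in it, all choices of data
    give the same hypersurface. *)
Lemma bisectorE p q : nrm p = 1 -> nrm q = 1 -> 1 < tau p q ->
  bisector h p q = [set x | x != 0 /\ im (bform p q x) = 0].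
Proof.
move=> np nq pq; apply/seteqP; split=> x [x0].
  move=> [W [f [w1 [w2 [D [w [Ww [a [b xE]]]]]]]]]; split=> //=.
  have [K _ [T _ WE]] := bisector_dataP np nq pq D.
  move: Ww xE; rewrite WE => -[s [t ->]] xE.
  by rewrite xE scalerDr !scalerA T !reimE; ring.
move=> /= ix; split=> //.
have [f [nf fp fq]] := common_polar np nq pq.
have [|W [w1 [w2 D]]] := bisector_data_exists np nq pq _ fp fq.
  by rewrite nf.
exists W, f, w1, w2; split=> //.
have [K K0 [T E WE]] := bisector_dataP np nq pq D.
have [a [b [c xE]]] := E x; rewrite WE.
have ab : im (b * a^*) = 0.
  rewrite xE T imM imC mulr0 add0r reC in ix; move/eqP: ix.
  by rewrite mulf_eq0 (lt_eqF K0) orbF => /eqP.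
have [a0|a0] := eqVneq a 0.
  exists w2; split; first by exists 0, 1; rewrite scale0r add0r scale1r.
  by exists b, c; rewrite xE a0 scale0r add0r.
exists (w1 + (re (b * a^*) / sqn a)%:C%C *: w2); split.
  by exists 1, (re (b * a^*) / sqn a); rewrite scale1r.
exists a, c; rewrite xE {1}(real_ratio a0 ab) scalerDr scalerA.
by rewrite (mulrC a).
Qed.

Lemma bisectorC p q : nrm p = 1 -> nrm q = 1 -> 1 < tau p q ->
  bisector h q p = bisector h p q.
Proof.
move=> np nq pq; rewrite !bisectorE // 1?tauC //.
apply/seteqP; split=> x [x0] /= ix; split=> //; move: ix; rewrite bformC im_conj; lra.
Qed.

(** As K < 0, the condition T <= 0 means b conj(a) >= 0. The ratio r = b / a >= 0 corresponds to the
    parameter t = r / (1 + r), and a = 0 to the end t = 1. *)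
Lemma bisector_segmentE p q : nrm p = 1 -> nrm q = 1 -> 1 < tau p q ->
  bisector_segment h p q = closed_ball h `&` [set x | bform p q x <= 0].
Proof.
move=> np nq pq; apply/seteqP; split=> x.
  move=> [W [f [w1 [w2 [D [t /andP[t0 t1] [cx [a [b xE]]]]]]]]]; split=> //=.
  have [K K0 [T _ _]] := bisector_dataP np nq pq D.
  rewrite xE scalerDr !scalerA T.
  have -> : a * t%:C%C * (a * (1 - t)%:C%C)^* * K%:C%C =
      (sqn a * (t * (1 - t)) * K)%:C%C.
    by rewrite rmorphM /= conjC_real !realCM -mulC_conj; ring.
  by rewrite cplx_le0 eqxx /= mulr_ge0_le0 ?(ltW K0) // !mulr_ge0 ?sqn_ge0 ?subr_ge0.
move=> [cx /=].
have [f [nf fp fq]] := common_polar np nq pq.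
have [|W [w1 [w2 D]]] := bisector_data_exists np nq pq _ fp fq.
  by rewrite nf.
have [K K0 [T E WE]] := bisector_dataP np nq pq D.
have [a [b [c xE]]] := E x; rewrite {1}xE T cplx_le0 imM imC mulr0 add0r reC.
rewrite mulf_eq0 (lt_eqF K0) orbF reM imC mulr0 subr0 reC.
rewrite nmulr_lle0 // => /andP[/eqP ab ab0].
exists W, f, w1, w2; split=> //.
have [a0|a0] := eqVneq a 0.
  exists 1; first by rewrite ler01 lexx.
  split=> //; exists b, c.
  have -> : (1 - 1)%:C%C *: w1 + 1%:C%C *: w2 = w2.
    by rewrite subrr [_ *: w1]scale0r add0r [_ *: w2]scale1r.
  by rewrite xE a0 scale0r add0r.
pose r := re (b * a^*) / sqn a.
have r0 : 0 <= r by rewrite divr_ge0 ?sqn_ge0.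
have r1 : 1 + r != 0 by rewrite gt_eqF // ltr_wpDr.
have bE : b = r%:C%C * a := real_ratio a0 ab.
clearbody r; exists (r / (1 + r)).
  by rewrite divr_ge0 ?addr_ge0 //= ler_pdivrMr ?ltr_wpDr // mul1r lerDr ler01.
split=> //; exists (a * (1 + r)%:C%C), c.
rewrite xE {1}bE scalerDr !scalerA -!(mulrA a) -!realCM.
have -> : (1 + r) * (1 - r / (1 + r)) = 1 by field.
have -> : (1 + r) * (r / (1 + r)) = r by field.
by rewrite [a * 1%:C%C]mulr1 (mulrC a).
Qed.

End Bisectors.

(** * Limits of complex functions and continuity of the Hermitian form *)

Section ComplexLimits.
Variables (R : realType) (T : Type) (F : set_system T).
Context {FF : Filter F}.
Implicit Types (f : T -> Cplx R) (z : Cplx R).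

Lemma cvg_re f z : f @ F --> z -> (fun t => re (f t)) @ F --> re z.
Proof.
move=> /cvgrPdist_lt fz; apply/cvgrPdist_lt => e e0.
have e0' : 0 < (e%:C%C : Cplx R) by rewrite cplx_gt0 eqxx.
near=> t; rewrite -ltcR -reN -reD (le_lt_trans (normc_ge_Re _)) //.
by near: t; exact: fz.
Unshelve. all: by end_near. Qed.

Lemma cvg_im f z : f @ F --> z -> (fun t => im (f t)) @ F --> im z.
Proof.
move=> fz.
have E (w : Cplx R) : im w = re (- 'i%C * w) by case: w => a b /=; ring.
rewrite E; under eq_fun do rewrite E.
exact: (cvg_re (cvgM (cvg_cst (- 'i%C : Cplx R)) fz)).
Qed.

Lemma cvg_realC (f : T -> R) (a : R) :
  f @ F --> a -> (fun t => (f t)%:C%C : Cplx R) @ F --> (a%:C%C : Cplx R).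
Proof.
move=> /cvgrPdist_lt fz; apply/cvgrPdist_lt => -[e1 e2].
rewrite cplx_gt0 /= => /andP[/eqP -> e0].
near=> t; rewrite -realCN -realCD normc_def /= expr0n addr0 sqrtr_sqr ltcR.
by near: t; exact: fz.
Unshelve. all: by end_near. Qed.

Lemma cvg_conj f z : f @ F --> z -> (fun t => (f t)^*) @ F --> z^*.
Proof.
move=> /cvgrPdist_lt fz; apply/cvgrPdist_lt => e e0.
near=> t; rewrite -rmorphB norm_conjC.
by near: t; exact: fz.
Unshelve. all: by end_near. Qed.

Lemma cvg_sqn f z : f @ F --> z -> (fun t => sqn (f t)) @ F --> sqn z.
Proof.
move=> fz; have a := cvg_re fz; have b := cvg_im fz.
exact: (cvgD (cvgM a a) (cvgM b b)).
Qed.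

Variable h : herm R.
Implicit Types (x y : T -> vec R) (a b : vec R).

(** The form is given only algebraically; its continuity comes from expanding the first argument in
    coordinates and from Hermitian symmetry. *)
Lemma h_coordinates : exists (e : 'I_3 -> vec R) (i j k : 'I_3),
  forall u b : vec R,
    h u b = u 0 i * h (e i) b + (u 0 j * h (e j) b + u 0 k * h (e k) b).
Proof.
have [e eE] : exists e : 'I_3 -> vec R, forall u : vec R,
    u = \sum_j u 0 j *: e j.
  by exists (fun j => delta_mx 0 j) => u; rewrite -row_sum_delta.
exists e, ord0, (lift ord0 ord0), (lift ord0 (lift ord0 ord0)) => u b.
have := congr1 (h^~ b) (eE u); rewrite !big_ord_recl big_ord0 addr0 /= => ->.
by rewrite !hDl !hZl.
Qed.

Lemma cvg_h_of_cvgr x y a b : x @ F --> a ->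
  (forall e, (fun t => h e (y t)) @ F --> h e b) ->
  (fun t => h (x t) (y t)) @ F --> h a b.
Proof.
move=> xa yb; have [e [i [j [k E]]]] := h_coordinates.
rewrite E; under eq_fun do rewrite E.
have C l : (fun t => x t 0 l) @ F --> a 0 l.
  apply: (@cvg_comp _ _ _ x (fun M : vec R => M 0 l) F (nbhs a)) xa _.
  exact: coord_continuous.
have M l : (fun t => x t 0 l * h (e l) (y t) : Cplx R) @ F -->
    (a 0 l * h (e l) b : Cplx R).
  exact: (cvgM (C l) (yb (e l))).
exact: (cvgD (M i) (cvgD (M j) (M k))).
Qed.

Lemma cvg_hl x a b : x @ F --> a -> (fun t => h (x t) b) @ F --> h a b.
Proof. by move=> xa; apply: (cvg_h_of_cvgr xa) => e; exact: cvg_cst. Qed.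

Lemma cvg_hr x a b : x @ F --> a -> (fun t => h b (x t)) @ F --> h b a.
Proof.
move=> xa; rewrite hC; under eq_fun do rewrite hC.
exact/cvg_conj/cvg_hl.
Qed.

Lemma cvg_nrm x a : x @ F --> a -> (fun t => hnorm h (x t)) @ F --> hnorm h a.
Proof.
by move=> xa; apply: cvg_re; apply: (cvg_h_of_cvgr xa) => e; exact: cvg_hr.
Qed.

End ComplexLimits.


(** * Tangent spaces of bisectors and tangent half-spaces of segments *)

Section Tangents.
Variable R : realType.
Variable h : herm R.
Hypothesis hsig : signature_mpp h.
Local Notation nrm := (hnorm h).
Local Notation tau := (tance h).
Local Notation bform := (bform h).
Implicit Types (x y z u v w f p q : vec R).

Section Curve.
Variables (F : set_system R) (g : R -> vec R) (x v : vec R).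
Context {FF : ProperFilter F}.
Hypothesis F0 : F --> (0 : R).
Hypothesis Fn0 : \forall t \near F, t != 0.
Hypothesis gv : (t^-1)%:C%C *: (g t - x) @[t --> F] --> v.

(** The filter stays general, to serve both punctured and right neighbourhoods of 0. *)
Lemma cvg_curve : g @ F --> x.
Proof.
have -> : x = (0 : Cplx R) *: v + x by rewrite scale0r add0r.
apply: cvg_trans (cvgD (cvgZ (cvg_realC F0) gv) (cvg_cst x)).
apply: near_eq_cvg; near=> t.
have t0 : t != 0 by near: t.
by rewrite !fctE /= scalerA -realCM divff // [1%:C%C *: _]scale1r subrK.
Unshelve. all: by end_near. Qed.

(** The first factor of T vanishes at x, so it is the only one that has to be differentiated. *)
Lemma cvg_curve_bform p q : h x p = 0 ->
  (fun t => (t^-1)%:C%C * bform p q (g t)) @ F --> h v p * h p q * h q x.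
Proof.
move=> xp.
have A : (fun t => h ((t^-1)%:C%C *: (g t - x)) p) @ F --> h v p by exact: cvg_hl.
have B : (fun t => h q (g t)) @ F --> h q x by apply: cvg_hr; exact: cvg_curve.
have C : (fun=> h p q) @ F --> h p q by exact: cvg_cst.
apply: cvg_trans (cvgM (cvgM A C) B).
apply: near_eq_cvg; near=> t.
by rewrite /= /bform hZl hDl hNl xp; ring.
Unshelve. all: by end_near. Qed.

End Curve.

(* A curve through x whose points y satisfy [bform p q y = t r + O(t^2)], real. *)
Definition bcurve p q x v (r : R) (t : R) : vec R :=
  let y := x + t%:C%C *: (v - h v p *: p) in
  y + ((t * r)%:C%C / (h p q * h q y)) *: p.

Section BisectorCurve.
Variables (p q x v : vec R) (r : R).
Hypotheses (np : nrm p = 1) (xp : h x p = 0) (K0 : h p q * h q x != 0).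
Hypothesis rE : h v p * (h p q * h q x) = r%:C%C.

Local Notation y t := (x + t%:C%C *: (v - h v p *: p)).
Local Notation K t := (h p q * h q (y t)).

Lemma bcurve_base t : h (y t) p = 0.
Proof. by rewrite hDl hZl hDl hNl hZl (nrm_unit_h np) xp; ring. Qed.

Lemma bcurve0 : bcurve p q x v r 0 = x.
Proof. by rewrite /bcurve mul0r scale0r addr0 mul0r scale0r addr0. Qed.

(** The correction along p divides by <p,q><q,y>, so the value is real for every t and not merely to
    first order: the curve stays on the bisector. For small t > 0 the sign is that of r. *)
Lemma bform_bcurve t : K t != 0 ->
  bform p q (bcurve p q x v r t) =
  (t * r * (1 + t * r * (tau p q / sqn (K t))))%:C%C.
Proof.
rewrite /bform /bcurve /=; have := bcurve_base t; move: (y t) => y yp k0.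
rewrite hDl hZl yp (nrm_unit_h np) mulr1 add0r hDr hZr -mulrA mulrDr.
set k := h p q * h q y in k0 *; set m := (t * r)%:C%C / k.
have -> : h p q * (m^* * h q p) = m^* * (tau p q)%:C%C by rewrite -h_mul_tau; ring.
rewrite mulrDr [m * k]mulfVK // mulrA mulC_conj sqnM sqn_real -realCM -realCD.
have -> : sqn k^-1 = (sqn k)^-1.
  apply: (@mulIf _ (sqn k)); first by rewrite sqn_eq0.
  by rewrite -sqnM !mulVf ?sqn_eq0 // (sqn_real (1 : R)) expr1n.
by congr (_%:C)%C; ring.
Qed.

Lemma bcurve_neq0 t : K t != 0 -> bcurve p q x v r t != 0.
Proof.
rewrite /bcurve; have := bcurve_base t; move: (y t) => y yp k0; apply/eqP => g0.
have /eqP := congr1 (h^~ p) g0; rewrite h0l hDl hZl yp (nrm_unit_h np) mulr1 add0r.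
move/eqP => m0; move: g0; rewrite m0 scale0r addr0 => y0.
by rewrite y0 h0r mulr0 eqxx in k0.
Qed.

Lemma cvg_bcurve_K (F : set_system R) {FF : Filter F} : F --> (0 : R) ->
  (fun t => K t) @ F --> h p q * h q x.
Proof.
move=> F0; move: (v - h v p *: p) => u.
have x0 : x + (0 : R)%:C%C *: u = x by rewrite (scale0r u) addr0.
have D : (fun t => x + t%:C%C *: u) @ F --> x.
  rewrite -[X in _ --> X]x0.
  exact: (cvgD (cvg_cst x) (cvgZ (cvg_realC F0) (cvg_cst u))).
exact: (cvgM (cvg_cst (h p q)) (cvg_hr D)).
Qed.

Lemma bcurve_velocity (F : set_system R) {FF : Filter F} : F --> (0 : R) ->
  (\forall t \near F, t != 0) ->
  (t^-1)%:C%C *: (bcurve p q x v r t - x) @[t --> F] --> v.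
Proof.
move=> F0 Fn0.
have E : v = (v - h v p *: p) + (r%:C%C * (h p q * h q x)^-1) *: p.
  by rewrite -rE mulfK // subrK.
rewrite [X in _ --> X]E.
have A : (fun t => r%:C%C * (K t)^-1 : Cplx R) @ F -->
    (r%:C%C * (h p q * h q x)^-1 : Cplx R).
  exact: (cvgM (cvg_cst (r%:C%C : Cplx R)) (cvgV K0 (cvg_bcurve_K F0))).
have B := cvgD (cvg_cst (v - h v p *: p)) (cvgZ A (cvg_cst p)).
apply: cvg_trans; last exact: B.
apply: near_eq_cvg; near=> t.
have t0 : t != 0 by near: t.
have sub3 (a b : vec R) : x + a + b - x = a + b by rewrite -(addrA x a b) (addrC x) addrK.
rewrite fctE /bcurve /= sub3 [RHS]scalerDr; congr (_ + _).
  by rewrite scalerA -realCM mulVf // (scale1r (v - h v p *: p)).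
rewrite [RHS]scalerA; congr (_ *: _).
by rewrite realCM !mulrA -realCM mulVf // mul1r.
Unshelve. all: by end_near. Qed.

End BisectorCurve.

(** A point orthogonal to p and q is orthogonal to p - <p,q> q, of norm 1 - ta(p, q) < 0, and would
    therefore be positive. *)
Lemma cgeod_pairing_neq0 p q x : nrm p = 1 -> nrm q = 1 -> 1 < tau p q ->
  cgeod h p x -> h p q * h q x != 0.
Proof.
move=> np nq pq [[x0 xx] xp]; rewrite hxx_le0 in xx.
have pq0 : h p q != 0 by rewrite -sqn_eq0 gt_eqF // (lt_trans ltr01).
rewrite mulf_neq0 //; apply/eqP => qx.
have [c [r o]] := extend_frame hsig np.
have [fp fq nf _] := orth_complement q o.
pose f := p - h p q *: q.
have nf' : nrm f < 0.
  rewrite /f nrmD -scaleN1r !nrmZ np nq !hZr.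
  rewrite /tance in pq *; rewrite /sqn in pq *; rewrite !reimE; nra.
have xf : h x f = 0.
  by rewrite /f hDr hNr hZr xp (h_eq0C qx) mulr0 oppr0 addr0.
have := orth_neg_gt0 hsig nf' xf x0; lra.
Qed.

Lemma near_pairing_neq0 p q x v (F : set_system R) {FF : Filter F} :
  h p q * h q x != 0 -> F --> (0 : R) ->
  \forall t \near F, h p q * h q (x + t%:C%C *: (v - h v p *: p)) != 0.
Proof.
move=> K0 F0.
have L : (fun t => h p q * h q (x + t%:C%C *: (v - h v p *: p)) : Cplx R) @ F -->
    (h p q * h q x : Cplx R) by exact: cvg_bcurve_K.
exact: cvgr_neq0 L K0.
Qed.

Lemma cvg_dnbhs_id : (0 : R)^' --> (0 : R).
Proof. exact: cvg_within. Qed.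

Lemma cvg_at_right_id : (0 : R)^'+ --> (0 : R).
Proof. exact: cvg_within. Qed.

Lemma at_right_neq0 : \forall t \near (0 : R)^'+, t != 0.
Proof. by near do rewrite gt_eqF //. Unshelve. all: by end_near. Qed.

Lemma cvg_im_eq0 (F : set_system R) {FF : ProperFilter F} (f : R -> Cplx R) (z : Cplx R) :
  f @ F --> z -> (\forall t \near F, im (f t) = 0) -> im z = 0.
Proof.
move=> /cvg_im fz f0; apply: (@cvg_unique R (@Rhausdorff R) _ _ _ _ fz).
exact: cvg_near_cst.
Qed.

Lemma cvg_re_le0 (F : set_system R) {FF : ProperFilter F} (f : R -> Cplx R) (z : Cplx R) :
  f @ F --> z -> (\forall t \near F, re (f t) <= 0) -> re z <= 0.
Proof. by move=> /cvg_re fz f0; exact: cvgr_to_le fz f0. Qed.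

(** Differentiating Im T = 0 gives one direction; [bcurve] realizes every remaining vector.
    Isotropic points of the slice are included. *)
Lemma tangent_bisectorE p q x v : nrm p = 1 -> nrm q = 1 -> 1 < tau p q ->
  cgeod h p x ->
  tangent (bisector h p q) x v <-> im (h v p * (h p q * h q x)) = 0.
Proof.
move=> np nq pq cx; have K0 := cgeod_pairing_neq0 np nq pq cx.
have xp : h x p = 0 by case: cx.
rewrite bisectorE //; split=> [[g [g0 gS gv]]|r0].
  have L := cvg_curve_bform (q := q) cvg_dnbhs_id (nbhs_dnbhs_neq _) gv xp.
  rewrite mulrA; apply: (cvg_im_eq0 (L _)).
  apply: (@cvg_dnbhs_id); apply: filterS gS => t [_ /= e].
  by rewrite imM e imC mulr0 mul0r addr0.
exists (bcurve p q x v (re (h v p * (h p q * h q x)))).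
have rE : h v p * (h p q * h q x) = (re (h v p * (h p q * h q x)))%:C%C.
  by apply: complex_eq; rewrite ?reC ?imC.
split; first exact: bcurve0.
- have N : \forall t \near (0 : R),
      h p q * h q (x + t%:C%C *: (v - h v p *: p)) != 0.
    exact: (@near_pairing_neq0 p q x v (nbhs (0 : R)) _ K0 (@cvg_id _ _)).
  apply: filterS N => t Kt; split; last by rewrite /= bform_bcurve.
  exact: bcurve_neq0.
- by apply: bcurve_velocity => //; [exact: cvg_dnbhs_id|exact: nbhs_dnbhs_neq].
Qed.

(** The segment also requires points of the closed ball; negativity of x keeps the curve inside. The
    factor multiplying t r along [bcurve] tends to 1, so T <= 0 for small t > 0. *)
Lemma half_tangent_segmentE p q x v : nrm p = 1 -> nrm q = 1 -> 1 < tau p q ->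
  cgeod h p x -> nrm x < 0 ->
  half_tangent (bisector_segment h p q) x v <-> h v p * (h p q * h q x) <= 0.
Proof.
move=> np nq pq cx nx; have K0 := cgeod_pairing_neq0 np nq pq cx.
have xp : h x p = 0 by case: cx.
rewrite bisector_segmentE // cplx_le0; split=> [[g [g0 gS gv]]|/andP[/eqP r0 rn]].
  have L := cvg_curve_bform (q := q) cvg_at_right_id at_right_neq0 gv xp.
  have gS' : \forall t \near (0 : R)^'+, im ((t^-1)%:C%C * bform p q (g t)) = 0 /\
      re ((t^-1)%:C%C * bform p q (g t)) <= 0.
    near=> t.
    have t0 : 0 < t by [].
    have [_ /=] : (closed_ball h `&` [set x | bform p q x <= 0]) (g t) by near: t.
    move: (bform p q (g t)) => z; rewrite cplx_le0 => /andP[/eqP iz rz].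
    by rewrite reM imM reC imC iz !(mulr0, mul0r) addr0 subr0 pmulr_rle0 ?invr_gt0.
  have {}L := L (at_right_proper_filter _).
  rewrite !mulrA (cvg_im_eq0 L) ?eqxx /=; last by apply: filterS gS' => t [].
  by apply: (cvg_re_le0 L); apply: filterS gS' => t [].
set r := re _ in rn.
have rE : h v p * (h p q * h q x) = r%:C%C.
  by apply: complex_eq; rewrite ?reC ?imC.
have gv : (t^-1)%:C%C *: (bcurve p q x v r t - x) @[t --> (0 : R)^'+] --> v.
  by apply: bcurve_velocity => //; [exact: cvg_at_right_id|exact: at_right_neq0].
have gx := cvg_curve cvg_at_right_id at_right_neq0 gv.
exists (bcurve p q x v r); split => //; first exact: bcurve0.
have nF : (fun t => nrm (bcurve p q x v r t)) @ (0 : R)^'+ --> nrm x.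
  by apply: cvg_nrm; exact: gx.
have KF : (fun t => h p q * h q (x + t%:C%C *: (v - h v p *: p)) : Cplx R)
    @ (0 : R)^'+ --> (h p q * h q x : Cplx R).
  by apply: cvg_bcurve_K; exact: cvg_at_right_id.
have sF : 1 + t * r * (tau p q / sqn (h p q * h q (x + t%:C%C *: (v - h v p *: p))))
    @[t --> (0 : R)^'+] --> (1 : R).
  have k0 : sqn (h p q * h q x) != 0 by rewrite sqn_eq0.
  have := cvgD (cvg_cst (1 : R)) (cvgM (cvgM cvg_at_right_id (cvg_cst r))
    (cvgM (cvg_cst (tau p q)) (cvgV k0 (cvg_sqn KF)))).
  by rewrite !mul0r addr0; apply.
near=> t.
have t0 : 0 < t by [].
have Kt : h p q * h q (x + t%:C%C *: (v - h v p *: p)) != 0.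
  by near: t; exact: near_pairing_neq0 K0 cvg_at_right_id.
split; first split.
- exact: bcurve_neq0.
- rewrite hxx_le0 ltW //; near: t; exact: cvgr_lt nF _ nx.
- rewrite /= bform_bcurve // cplx_le0 eqxx /= mulr_le0_ge0 //.
    by rewrite pmulr_rle0.
  by near: t; exact: cvgr_ge sF _ ltr01.
Unshelve. all: by end_near. Qed.

End Tangents.

(** * The cone of a vertex and the signs forced by the vertex condition *)

Section Vertices.
Variable R : realType.

(* The condition for the sides pq and pr to be transversal along C_p, where
   a = ta(p, q), b = ta(p, r) and x is the real part of <p,q><q,r><r,p>. *)
Definition vertex_cond (a b x : R) : Prop :=
  (x - a * b) ^+ 2 < a * b * ((a - 1) * (b - 1)).

(* A cone of pairs (z, w) cut out by an indefinite Hermitian form; the product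
   z w^* then avoids the real line rotated by e^*. *)
Lemma sector_im (A B : R) (z w g e : Cplx R) : 0 < A -> 0 < B ->
  z != 0 -> w != 0 ->
  B * sqn z + A * sqn w + 2 * re (z * w^* * g) <= 0 ->
  re (g * e^*) ^+ 2 < A * B * sqn e ->
  0 < im (z * w^* * e) * im (g * e^*).
Proof.
move=> A0 B0 z0 w0 cone ge.
have e0 : 0 < sqn e.
  by rewrite -(pmulr_rgt0 _ (mulr_gt0 A0 B0)) (le_lt_trans _ ge) ?sqr_ge0.
have Z0 : 0 < sqn z by rewrite sqn_gt0.
have W0 : 0 < sqn w by rewrite sqn_gt0.
pose T := - re (z * w^* * g) * sqn e.
have TE : T = im (z * w^* * e) * im (g * e^*) - re (z * w^* * e) * re (g * e^*).
  by rewrite /T /sqn !reimE; ring.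
have T0 : 0 <= T by rewrite mulr_ge0 ?(ltW e0) //; nra.
(* The cone inequality bounds B|z|^2 + A|w|^2 above, and AM-GM bounds it below by 2 sqrt(AB)
   |z||w|. *)
have T2 : A * B * sqn e * (re (z * w^* * e) ^+ 2 + im (z * w^* * e) ^+ 2) <= T ^+ 2.
  have -> : re (z * w^* * e) ^+ 2 + im (z * w^* * e) ^+ 2 =
      sqn z * sqn w * sqn e by rewrite -(sqn_conj w) -!sqnM.
  rewrite /T exprMn sqrrN.
  have -> : A * B * sqn e * (sqn z * sqn w * sqn e) =
      (A * B * (sqn z * sqn w)) * sqn e ^+ 2 by ring.
  rewrite ler_pM2r ?exprn_gt0 //.
  have h1 : B * sqn z + A * sqn w <= - 2 * re (z * w^* * g) by lra.
  have h2 : 0 <= B * sqn z + A * sqn w by rewrite addr_ge0 // mulr_ge0 // ltW.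
  have h3 : (B * sqn z + A * sqn w) ^+ 2 <= (- 2 * re (z * w^* * g)) ^+ 2.
    by rewrite ler_pXn2r ?nnegrE // (le_trans h2).
  have := sqr_ge0 (B * sqn z - A * sqn w); move: h3; lra.
have S0 : 0 < re (z * w^* * e) ^+ 2 + im (z * w^* * e) ^+ 2.
  rewrite -[X in 0 < X]/(sqn (z * w^* * e)) !sqnM sqn_conj.
  by rewrite !mulr_gt0.
move: TE T0 T2 S0 ge; move: T (re (z * w^* * e)) (im (z * w^* * e)).
move: (re (g * e^*)) (im (g * e^*)) (A * B * sqn e) => al be m {cone e0 Z0 W0 z0 w0}.
(* If v be <= 0 then 0 <= T <= - u al, so m (u^2 + v^2) <= T^2 <= u^2 al^2, contradicting al^2 < m.
   The case u = 0 is separate because that strict inequality is multiplied by u^2. *)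
move=> T u v TE T0 T2 S0 ge; rewrite ltNge; apply/negP => vb.
have Tu : T ^+ 2 <= u ^+ 2 * al ^+ 2.
  have : T <= - (u * al) by lra.
  by rewrite -exprMn -(sqrrN (u * al)) => ?; rewrite ler_pXn2r ?nnegrE // (le_trans T0).
have m0 : 0 < m by apply: le_lt_trans ge; rewrite sqr_ge0.
have [u0|u0] := eqVneq u 0.
  by move: S0 T2 Tu; rewrite u0 expr0n /= !add0r mul0r => S0 T2 Tu;
    have := mulr_gt0 m0 S0; lra.
have up : 0 < u ^+ 2 by rewrite exprn_even_gt0.
have : u ^+ 2 * al ^+ 2 < u ^+ 2 * m by rewrite ltr_pM2l.
have : 0 <= m * v ^+ 2 by rewrite mulr_ge0 ?sqr_ge0 // ltW.
lra.
Qed.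

Variable h : herm R.
Hypothesis hsig : signature_mpp h.
Local Notation nrm := (hnorm h).
Local Notation tau := (tance h).
Local Notation bform := (bform h).
Implicit Types (x y v w f p q r : vec R).

Section NegativePair.
Variables (P Q : vec R) (A B : R) (g : Cplx R).
Hypotheses (A0 : 0 < A) (PP : h P P = (- A)%:C%C) (QQ : h Q Q = (- B)%:C%C).
Hypothesis PQ : h P Q = g.

Let QP : h Q P = g^*. Proof. by rewrite hC PQ. Qed.
Let nP : nrm P < 0. Proof. by rewrite /hnorm PP reC oppr_lt0. Qed.
Let Q' := A%:C%C *: Q + g^* *: P.
Let Q'P : h Q' P = 0.
Proof. by rewrite /Q' hDl !hZl QP PP realCN; ring. Qed.
Let nQ' : nrm Q' = A * (sqn g - A * B).
Proof.
rewrite /Q' nrmD !nrmZ sqn_real /hnorm QQ PP !reC hZl hZr QP sqn_conj !reimE /sqn.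
ring.
Qed.

(** [Q'] is A times the projection of Q to the complement of P, where the form is positive
    definite. *)
Lemma negative_pair_gram : A * B <= sqn g.
Proof.
by have := orth_neg_ge0 hsig nP Q'P; rewrite nQ' pmulr_rge0 // subr_ge0.
Qed.

(** Cauchy-Schwarz in the complement of P, for the projections of x and Q scaled by A; the term with
    <x,x> <= 0 is dropped. *)
Lemma negative_pair_cone x : nrm x <= 0 ->
  B * sqn (h x P) + A * sqn (h x Q) + 2 * re (h x P * (h x Q)^* * g) <= 0.
Proof.
move=> nx; pose x' := A%:C%C *: x + h x P *: P.
have x'P : h x' P = 0 by rewrite /x' hDl !hZl PP realCN; ring.
have nx' : nrm x' = A * (A * nrm x + sqn (h x P)).
  rewrite /x' nrmD !nrmZ sqn_real hZl hZr /hnorm PP /sqn !reimE; ring.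
have x'Q' : h x' Q' = A%:C%C * (A%:C%C * h x Q + h x P * g).
  by rewrite /Q' hDr !hZr x'P conjC_real mulr0 addr0 /x' hDl !hZl PQ.
have Qge := orth_neg_ge0 hsig nP Q'P.
have := orth_neg_cauchy hsig nP x'P Q'P.
rewrite x'Q' nx' nQ' sqnM sqn_real expr2.
have -> : A * (A * nrm x + sqn (h x P)) * (A * (sqn g - A * B)) =
    A * A * ((A * nrm x + sqn (h x P)) * (sqn g - A * B)) by ring.
rewrite ler_pM2l ?mulr_gt0 //.
rewrite nQ' pmulr_rge0 // in Qge.
have An : A * nrm x + sqn (h x P) <= sqn (h x P) by rewrite gerDr pmulr_rle0.
move=> cs; have {}cs := le_trans cs (ler_wpM2r Qge An).
have {}cs : A * (B * sqn (h x P) + A * sqn (h x Q) + 2 * re (h x P * (h x Q)^* * g)) <= 0.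
  move: cs.
  have -> : sqn (A%:C%C * h x Q + h x P * g) = A ^+ 2 * sqn (h x Q) +
      sqn (h x P) * sqn g + 2 * A * re (h x P * (h x Q)^* * g).
    by rewrite /sqn !reimE; ring.
  lra.
by rewrite pmulr_rle0 in cs.
Qed.

End NegativePair.

(** The Hermitian triple product, unchanged when the representatives are multiplied by phases. Its
    real and imaginary parts are the x and y of the overview. *)
Definition gram3 p q r : Cplx R := h p q * h q r * h r p.
Local Notation kappa := gram3.

Lemma sqn_kappa p q r : sqn (kappa p q r) = tau p q * tau q r * tau p r.
Proof. by rewrite /kappa !sqnM (tauC _ p r). Qed.

Lemma kappa_rot p q r : kappa q r p = kappa p q r.
Proof. by rewrite /kappa; ring. Qed.

Section Vertex.
Variables p q r : vec R.
Hypotheses (np : nrm p = 1) (nq : nrm q = 1) (nr : nrm r = 1).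
Hypotheses (pq : 1 < tau p q) (pr : 1 < tau p r).

Local Notation a := (tau p q).
Local Notation b := (tau p r).
Local Notation k := (kappa p q r).
Local Notation A := (a * (a - 1)).
Local Notation B := (b * (b - 1)).
Local Notation g := (kappa p q r - (a * b)%:C%C).
Local Notation z x := (h x q * h q p).
Local Notation w x := (h x r * h r p).

Let A0 : 0 < A. Proof. by rewrite mulr_gt0 ?subr_gt0 // (lt_trans ltr01). Qed.
Let B0 : 0 < B. Proof. by rewrite mulr_gt0 ?subr_gt0 // (lt_trans ltr01). Qed.

(** P and Q are multiples of the projections of q and r to the complement of p. They represent the
    points where the real spines of the two sides meet C_p. *)
Lemma vertex_vectors : exists P Q,
  [/\ h P p = 0, h Q p = 0,
      forall x, h x p = 0 -> h x P = z x /\ h x Q = w x &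
      [/\ h P P = (- A)%:C%C, h Q Q = (- B)%:C%C & h P Q = g]].
Proof.
have hpp := nrm_unit_h np; have hqq := nrm_unit_h nq; have hrr := nrm_unit_h nr.
pose P := h p q *: q - a%:C%C *: p; pose Q := h p r *: r - b%:C%C *: p.
have Pp : h P p = 0 by rewrite /P hDl hNl !hZl hpp h_mul_tau; ring.
have Qp : h Q p = 0 by rewrite /Q hDl hNl !hZl hpp h_mul_tau; ring.
have xP x : h x p = 0 -> h x P = z x.
  by move=> xp; rewrite /P hDr hNr !hZr xp (hC q p); ring.
have xQ x : h x p = 0 -> h x Q = w x.
  by move=> xp; rewrite /Q hDr hNr !hZr xp (hC r p); ring.
exists P, Q; split; [exact: Pp|exact: Qp|by move=> x xp; rewrite xP ?xQ|].
split.
- rewrite xP // /P hDl hNl !hZl hqq mulr1 mulrBl h_mul_tau -mulrA h_mul_tau.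
  by rewrite -realCM -realCN -realCD; congr (_%:C)%C; ring.
- rewrite xQ // /Q hDl hNl !hZl hrr mulr1 mulrBl h_mul_tau -mulrA h_mul_tau.
  by rewrite -realCM -realCN -realCD; congr (_%:C)%C; ring.
- rewrite xQ // /P hDl hNl !hZl mulrBl -[_%:C%C * _ * _]mulrA h_mul_tau.
  by rewrite realCM /kappa.
Qed.

(** The left side is the Gram determinant of p, q, r, not positive in signature -++. It is the
    inequality of [negative_pair_gram] divided by ab. *)
Lemma gram_le0 : 2 * re k - a - b - tau q r + 1 <= 0.
Proof.
have [P [Q [_ _ _ [PP QQ PQ]]]] := vertex_vectors.
have := negative_pair_gram A0 PP QQ PQ.
have -> : sqn g = sqn k - 2 * (a * b) * re k + (a * b) ^+ 2.
  by rewrite /sqn !reimE; ring.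
rewrite sqn_kappa => e.
have : 0 <= a * b * - (2 * re k - a - b - tau q r + 1) by lra.
by rewrite pmulr_rge0 ?oppr_ge0 // mulr_gt0 // (lt_trans ltr01).
Qed.

Lemma vertex_cone x : h x p = 0 -> nrm x <= 0 ->
  B * sqn (z x) + A * sqn (w x) + 2 * re (z x * (w x)^* * g) <= 0.
Proof.
move=> xp nx; have [P [Q [_ _ H [PP QQ PQ]]]] := vertex_vectors.
by have := negative_pair_cone A0 PP QQ PQ nx; have [-> ->] := H x xp.
Qed.

Lemma vertex_zw_neq0 x : cgeod h p x -> z x != 0 /\ w x != 0.
Proof.
move=> cx; have cq := cgeod_pairing_neq0 hsig np nq pq cx.
have cr := cgeod_pairing_neq0 hsig np nr pr cx.
by split; [rewrite (hC x q) (hC q p)|rewrite (hC x r) (hC r p)];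
  rewrite -rmorphM conjC_eq0 mulrC.
Qed.

Let cgeod_nrm x : cgeod h p x -> h x p = 0 /\ nrm x <= 0.
Proof. by move=> [[_]]; rewrite hxx_le0. Qed.

(** The case e = 1 of [sector_im]: z conj(w) stays off the real line, on the same side at all points
    of the closed slice. *)
Lemma vertex_sign x : vertex_cond a b (re k) -> cgeod h p x ->
  0 < im (z x * (w x)^*) * im k.
Proof.
move=> V cx; have [z0 w0] := vertex_zw_neq0 cx; have [xp nx] := cgeod_nrm cx.
have := sector_im A0 B0 z0 w0 (vertex_cone xp nx) (e := 1).
rewrite conjC1 !mulr1 [im (k - _)]imD imN imC subr0; apply.
rewrite reD reN reC /sqn re1 im1; move: V; rewrite /vertex_cond; lra.
Qed.

(* The side qr does not meet C_p. *)
Lemma opposite_side_sign x : 1 < tau q r -> vertex_cond a (tau q r) (re k) ->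
  im k < 0 -> cgeod h p x -> im (bform q r x) < 0.
Proof.
move=> qr V k0 cx; have [z0 w0] := vertex_zw_neq0 cx; have [xp nx] := cgeod_nrm cx.
have G := gram_le0.
have ab0 : 0 < a * b by rewrite mulr_gt0 // (lt_trans ltr01).
have := sector_im A0 B0 z0 w0 (vertex_cone xp nx) (e := k).
have -> : im (g * k^*) = a * b * im k by rewrite !reimE; ring.
have -> : z x * (w x)^* * k = (a * b)%:C%C * bform q r x.
  rewrite realCM -!h_mul_tau /bform /kappa rmorphM /= -!hC; ring.
have -> : re (g * k^*) = a * b * (tau q r - re k).
  transitivity (sqn k - a * b * re k); first by rewrite /sqn !reimE; ring.
  by rewrite sqn_kappa; ring.
rewrite sqn_kappa imM imC reC mul0r addr0 => s.
have {}s : 0 < a * b * im (bform q r x) * (a * b * im k).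
  apply: s; move: V G; rewrite /vertex_cond.
  move: (re k) (tau q r) qr => X c qr V G.
  have -> : a * (a - 1) * (b * (b - 1)) * (a * c * b) =
    (a * b) ^+ 2 * (c * ((a - 1) * (b - 1))) by ring.
  rewrite exprMn ltr_pM2l ?exprn_gt0 //.
  (* This multiple of the Gram inequality, added to the vertex condition at q, gives (c - X)^2 < c
     (a - 1)(b - 1), the hypothesis of [sector_im] for e = k after division by (ab)^2. *)
  have : (a - 1) * c * (2 * X - a - b - c + 1) <= 0.
    by apply: mulr_ge0_le0 => //; rewrite mulr_ge0 ?subr_ge0 ?ltW // (lt_trans ltr01).
  lra.
move: s; rewrite nmulr_lgt0; last by rewrite nmulr_llt0.
by rewrite pmulr_rlt0.
Qed.

End Vertex.
End Vertices.

(** * Transversality and orientation in terms of tances and triple products *)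

Section VertexConditions.
Variable R : realType.
Variable h : herm R.
Hypothesis hsig : signature_mpp h.
Local Notation nrm := (hnorm h).
Local Notation tau := (tance h).
Local Notation bform := (bform h).
Local Notation kappa := (gram3 h).
Implicit Types (x y v w f p q r : vec R).

Section Vertex.
Variables p q r : vec R.
Hypotheses (np : nrm p = 1) (nq : nrm q = 1) (nr : nrm r = 1).
Hypotheses (pq : 1 < tau p q) (pr : 1 < tau p r).

Local Notation a := (tau p q).
Local Notation b := (tau p r).
Local Notation k := (kappa p q r).
Local Notation z x := (h x q * h q p).
Local Notation w x := (h x r * h r p).

Lemma vertex_cond_fails : ~ vertex_cond a b (re k) ->
  exists2 x, cgeod h p x & im (z x * (w x)^*) = 0.
Proof.
have [P [Q [Pp Qp H [PP QQ PQ]]]] := vertex_vectors np nq nr.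
have A0 : 0 < a * (a - 1) by rewrite mulr_gt0 ?subr_gt0 // (lt_trans ltr01).
have B0 : 0 < b * (b - 1) by rewrite mulr_gt0 ?subr_gt0 // (lt_trans ltr01).
have G := negative_pair_gram hsig A0 PP QQ PQ.
set A := a * (a - 1) in PP A0 G *; set B := b * (b - 1) in QQ B0 G *.
set g := k - _ in PQ G *.
have QP : h Q P = g^* by rewrite hC PQ.
have gE : re g = re k - a * b by rewrite /g reD reN.
clearbody g.
move=> V; have {}V : A * B <= re g ^+ 2.
  rewrite leNgt; apply/negP => v; apply: V; rewrite /vertex_cond -gE.
  by have -> : a * b * ((a - 1) * (b - 1)) = A * B by rewrite /A /B; ring.
(* If P and Q have zero Gram determinant, g is real and P itself is the required point. *)
have [D0|D0] := eqVneq (sqn g) (A * B).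
  exists P.
    split=> //; split; last by rewrite PP cplx_le0 eqxx /= oppr_le0 ltW.
    by apply: (@nrm_neq0 _ h); rewrite /hnorm PP reC oppr_eq0 gt_eqF.
  have [<- <-] := H _ Pp; rewrite PP PQ !reimE mul0r addr0.
  have : im g ^+ 2 <= 0 by move: V; rewrite -D0 /sqn; lra.
  rewrite real_exprn_even_le0 ?num_real //= => /eqP ->.
  by rewrite oppr0 mulr0.
have {D0 G} D0 : 0 < sqn g - A * B by rewrite subr_gt0 lt_neqAle eq_sym D0.
(* Real products s D and t D make z conj(w) real; the moduli sqrt A, sqrt B give equality in AM-GM,
   and the sign of t makes t Re g <= 0, so the norm of [x] is as small as possible. *)
pose s := Num.sqrt A; pose t := if 0 <= re g then - Num.sqrt B else Num.sqrt B.
have ss : s ^+ 2 = A by rewrite sqr_sqrtr ?ltW.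
have tt : t ^+ 2 = B.
  by rewrite /t; case: ifP => _; rewrite ?sqrrN sqr_sqrtr ?ltW.
have s0 : 0 < s by rewrite sqrtr_gt0.
have tg : t * re g = - (Num.sqrt B * `|re g|).
  rewrite /t; case: ifPn => [g0|]; first by rewrite ger0_norm // mulNr.
  by rewrite -ltNge => g0; rewrite ltr0_norm // mulrN opprK.
pose D := sqn g - A * B.
(* Cramer's rule for <x,P> = s D, <x,Q> = t D in the span of P and Q. *)
pose x := (B%:C%C * s%:C%C + g^* * t%:C%C) *: P + (A%:C%C * t%:C%C + g * s%:C%C) *: Q.
have gg : g * g^* = (D + A * B)%:C%C by rewrite mulC_conj /D subrK.
have xP : h x P = (s * D)%:C%C.
  rewrite /x hDl !hZl PP QP realCN.
  transitivity (s%:C%C * (g * g^* - A%:C%C * B%:C%C)); first by ring.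
  by rewrite gg -realCM -realCN -realCD addrK realCM.
have xQ : h x Q = (t * D)%:C%C.
  rewrite /x hDl !hZl PQ QQ realCN.
  transitivity (t%:C%C * (g * g^* - A%:C%C * B%:C%C)); first by ring.
  by rewrite gg -realCM -realCN -realCD addrK realCM.
have xp : h x p = 0 by rewrite /x hDl !hZl Pp Qp !mulr0 addr0.
have nx : nrm x = D * (2 * (A * B) + 2 * s * (t * re g)).
  rewrite /hnorm {2}/x hDr !hZr xP xQ !reimE -ss -tt; ring.
exists x; last first.
  by have [<- <-] := H _ xp; rewrite xP xQ conjC_real -realCM imC.
split=> //; split.
  apply/eqP => x0; move: xP; rewrite x0 h0l => /esym/realCI/eqP.
  by rewrite mulf_eq0 !gt_eqF.
rewrite hxx_le0 nx pmulr_rle0 // tg.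
suff : A * B <= s * (Num.sqrt B * `|re g|) by lra.
have AB0 : 0 < A * B by rewrite mulr_gt0.
rewrite /s mulrA -sqrtrM ?(ltW A0) //.
have : (A * B) ^+ 2 <= (Num.sqrt (A * B) * `|re g|) ^+ 2.
  by rewrite [leRHS]exprMn sqr_sqrtr ?(ltW AB0) // real_normK ?num_real // expr2 ler_pM2l.
by rewrite ler_pXn2r ?nnegrE ?(ltW AB0) ?mulr_ge0 ?sqrtr_ge0.
Qed.

Lemma transversal_vertexP :
  transversal_along h p (bisector h r p) (bisector h p q) <->
  vertex_cond a b (re k).
Proof.
rewrite bisectorC //; split=> [tr|V x cx v].
  case: (pselect (vertex_cond a b (re k))) => // V.
  have [x cx zw] := vertex_cond_fails V.
  have K0 := cgeod_pairing_neq0 hsig np nr pr cx.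
  have L0 := cgeod_pairing_neq0 hsig np nq pq cx.
  (* Here <v,p> = i w. With z conj(w) real both tangent spaces impose <.,p> in R w, so [v] is not in
     their sum. *)
  pose v := ('i%C * (h p r * h r x)^*) *: p.
  have [v1 [v2 []]] := tr _ cx v.
  move=> /(tangent_bisectorE hsig _ np nr pr cx) e1.
  move=> /(tangent_bisectorE hsig _ np nq pq cx) e2 e.
  have := congr1 (h^~ p) e; rewrite hDl /v hZl (nrm_unit_h np) mulr1.
  move: zw K0 L0 e1 e2; rewrite (hC x q) (hC q p) (hC x r) (hC r p).
  move: (h p q) (h q x) (h p r) (h r x) (h v1 p) (h v2 p) => c1 c2 d1 d2 m1 m2.
  have -> : c2^* * c1^* * (d2^* * d1^*)^* = (c1 * c2)^* * (d1 * d2).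
    by rewrite !rmorphM /= !conjCK; ring.
  move: (c1 * c2) (d1 * d2) => {c1 c2 d1 d2} c d cd d0 c0 e1 e2 e3.
  have e4 : im (m2 * d) = 0.
    have : im (m2 * d) * sqn c = 0.
      transitivity (im (m2 * c) * re (c^* * d) + re (m2 * c) * im (c^* * d)).
        by rewrite /sqn !reimE; ring.
      by rewrite e2 cd mul0r mulr0 addr0.
    by move/eqP; rewrite mulf_eq0 sqn_eq0 (negbTE c0) orbF => /eqP.
  have := congr1 (fun u : Cplx R => im (u * d)) e3.
  rewrite mulrDl imD e1 e4 addr0 => e5.
  have : sqn d = 0 by move: e5; rewrite /sqn !reimE /=; lra.
  by move/eqP; rewrite sqn_eq0 (negbTE d0).
have s0 : im (z x * (w x)^*) != 0.
  apply/eqP => s0; have := vertex_sign hsig np nq nr pq pr V cx.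
  by rewrite s0 mul0r ltxx.
pose s := im (z x * (w x)^*); pose m := h v p.
(* Cramer's rule over the reals: z and w form a real basis of the complex numbers, and <v,p> splits
   along it. *)
pose r2 := im (m * (w x)^*) / s; pose r1 := - im (m * (z x)^*) / s.
have mE : m = r1%:C%C * w x + r2%:C%C * z x.
  rewrite /r1 /r2 /s; move: (z x) (w x) (m) s0 => Z W M; rewrite !reimE => s0.
  by apply: complex_eq; rewrite !reimE; field.
exists (v - (r2%:C%C * z x) *: p), ((r2%:C%C * z x) *: p); split.
- apply/(tangent_bisectorE hsig _ np nr pr cx).
  rewrite hDl hNl hZl (nrm_unit_h np) mulr1 -/m mE addrK.
  rewrite (hC p r) (hC r x); move: (h x r) (h r p) => c d.
  by rewrite !reimE; ring.
- apply/(tangent_bisectorE hsig _ np nq pq cx).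
  rewrite hZl (nrm_unit_h np) mulr1.
  rewrite (hC p q) (hC q x); move: (h x q) (h q p) => c d.
  by rewrite !reimE; ring.
- by rewrite subrK.
Qed.

End Vertex.

(** The tangent half-space consists of the v with <v,p> a nonpositive multiple of z = <x,q><q,p>, so
    the normal points along - z p; the real factor gives it norm - <x,x>. *)
Lemma inward_normal_segment p q x : nrm p = 1 -> nrm q = 1 -> 1 < tau p q ->
  cgeod h p x -> nrm x < 0 ->
  inward_normal h p (bisector_segment h p q) x
    (- ((Num.sqrt (- nrm x) / Num.sqrt (sqn (h x q * h q p)))%:C%C
      * (h x q * h q p)) *: p).
Proof.
move=> np nq pq cx nx; have [[x0 xx] xp] := cx.
have K0 := cgeod_pairing_neq0 hsig np nq pq cx.
have -> : h x q * h q p = (h p q * h q x)^*.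
  by rewrite rmorphM /= -!hC mulrC.
move: (h p q * h q x) K0 (fun v => half_tangent_segmentE hsig v np nq pq cx nx).
move=> c c0 T; rewrite sqn_conj.
have s0 : 0 < sqn c by rewrite sqn_gt0.
set n := Num.sqrt (- nrm x); set m := Num.sqrt (sqn c).
have n0 : 0 < n by rewrite sqrtr_gt0 oppr_gt0.
have m0 : 0 < m by rewrite sqrtr_gt0.
have mm : m ^+ 2 = sqn c by rewrite sqr_sqrtr ?ltW.
have nn : n ^+ 2 = - nrm x by rewrite sqr_sqrtr // oppr_ge0 ltW.
have hpp := nrm_unit_h np.
split.
- rewrite !hxx nrmZ np mulr1 sqnN sqnM sqn_conj sqn_real -mm expr_div_n.
  by rewrite divfK ?expf_neq0 ?gt_eqF // nn realCN.
- by move=> u up; rewrite hZl (h_eq0C up) mulr0.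
move=> v; split=> [/T|[u [r [up r0 ->]]]].
  rewrite cplx_le0 => /andP[/eqP i0 r0].
  pose r := - re (h v p * c) / (n * m).
  exists (v - r%:C%C *: (- ((n / m)%:C%C * c^*) *: p)), r; split; last 1 first.
  - by rewrite subrK.
  - rewrite hDl hNl !hZl hpp mulr1 mulrN opprK mulrA -realCM.
    have -> : r * (n / m) = - re (h v p * c) / sqn c.
      by rewrite -mm /r; field; rewrite !gt_eqF.
    have vE : h v p * c = (re (h v p * c))%:C%C.
      by apply: complex_eq; rewrite ?reC ?imC.
    apply: (mulIf c0); rewrite mul0r mulrDl -mulrA (mulrC c^* c) mulC_conj {1}vE.
    by rewrite -realCM -realCD divfK ?gt_eqF // subrr.
  - by rewrite divr_ge0 ?oppr_ge0 // mulr_ge0 ?ltW.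
apply/T; rewrite hDl up add0r !hZl hpp mulr1.
have -> : r%:C%C * - ((n / m)%:C%C * c^*) * c = (- (r * (n / m * sqn c)))%:C%C.
  by rewrite realCN !realCM -mulC_conj; ring.
by rewrite cplx_le0 eqxx /= oppr_le0 mulr_ge0 // mulr_ge0 ?sqn_ge0 // divr_ge0 ?ltW.
Qed.

(** This applies to whichever normals the definition of the angle supplies. If <w,p> = 0, then w
    would be orthogonal to itself, although <w,w> = - <x,x> > 0. *)
Lemma inward_normal_pairing p q x w : nrm p = 1 -> nrm q = 1 -> 1 < tau p q ->
  cgeod h p x -> nrm x < 0 -> inward_normal h p (bisector_segment h p q) x w ->
  h w p * (h p q * h q x) < 0.
Proof.
move=> np nq pq cx nx [ww wu T].
have K0 := cgeod_pairing_neq0 hsig np nq pq cx.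
have hpp := nrm_unit_h np.
have : h w p * (h p q * h q x) <= 0.
  apply/(half_tangent_segmentE hsig w np nq pq cx nx)/T.
  by exists 0, 1; rewrite h0l ler01 add0r [1%:C%C *: _]scale1r.
rewrite le_eqVlt => /predU1P[] // /eqP; rewrite mulf_eq0 (negbTE K0) orbF => /eqP wp.
exfalso; move: ww; rewrite wu // hxx -realCN => /realCI; lra.
Qed.

(** The inner normals are negative multiples of z p and w p, so the oriented angle is minus the
    argument of z conj(w); it lies in (0, pi) iff Im(z conj(w)) < 0, whose sign is that of Im k by
    [vertex_sign]. *)
Lemma ccw_triangleP p q r : nrm p = 1 -> nrm q = 1 -> nrm r = 1 ->
  1 < tau p q -> 1 < tau p r -> vertex_cond (tau p q) (tau p r) (re (kappa p q r)) ->
  ccw_triangle h p q r <-> im (kappa p q r) < 0.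
Proof.
move=> np nq nr pq pr V; split=> [ccw|k0 x cx].
  have [c [s o]] := extend_frame hsig np; have [nc _ _] := orthonormal_nrm o.
  have nc0 : nrm c < 0 by rewrite nc ltrN10.
  have cc : cgeod h p c.
    split; last by case: o => _ [].
    split; last by rewrite hxx_le0 ltW.
    by apply: (@nrm_neq0 _ h); rewrite lt_eqF.
  have cl : h c c < 0 by rewrite hxx_lt0.
  have [t tp [_ [w1 [w2 [i1 i2 e]]]]] := ccw c cc cl.
  have l1 := inward_normal_pairing np nq pq cc nc0 i1.
  have l2 := inward_normal_pairing np nr pr cc nc0 i2.
  have := vertex_sign hsig np nq nr pq pr V cc.
  suff : im (h c q * h q p * (h c r * h r p)^*) < 0 by move=> ?; rewrite nmulr_rgt0.
  have -> : h c q * h q p * (h c r * h r p)^* = (h p q * h q c)^* * (h p r * h r c).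
    by rewrite !rmorphM /= -!hC; ring.
  move: l1 l2; rewrite e hZl.
  have := cos2Dsin2 t; have := sin_gt0_pi tp.
  move: (h p q * h q c) (h p r * h r c) (h w1 p) (sin t) (cos t).
  move=> z w m sn cs s0 cs2; rewrite !cplx_lt0 => /andP[/eqP j1 r1] /andP[/eqP j2 r2].
  have E : (m * z)^* * ((cs +i* sn)%C * m * w) =
      (sqn m)%:C%C * ((cs +i* sn)%C * (z^* * w)).
    by rewrite -mulC_conj rmorphM; ring.
  have M0 : 0 < sqn m.
    by rewrite sqn_gt0; apply/eqP => m0; move: r1; rewrite m0 mul0r ltxx.
  move: E j1 r1 j2 r2; move: (m * z) (_ * m * w) (z^* * w) => u1 u2 S E j1 r1 j2 r2.
  have rE : re u1 * re u2 = sqn m * (cs * re S - sn * im S).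
    by have := congr1 (@complex.Re R) E; rewrite !reimE /= j1 j2; lra.
  have iE : sqn m * (cs * im S + sn * re S) = 0.
    by have := congr1 (@complex.Im R) E; rewrite !reimE /= j1 j2; lra.
  have {}rE : 0 < cs * re S - sn * im S.
    by rewrite -(pmulr_rgt0 _ M0) -rE nmulr_rgt0.
  have {}iE : cs * im S + sn * re S = 0.
    by move/eqP: iE; rewrite mulf_eq0 gt_eqF //= => /eqP.
  have : 0 < sn * (cs * re S - sn * im S) by rewrite mulr_gt0.
  have -> : sn * (cs * re S - sn * im S) =
      cs * (cs * im S + sn * re S) - (cs ^+ 2 + sn ^+ 2) * im S by ring.
  by rewrite iE cs2; lra.
rewrite hxx_lt0 => nx'.
have I1 := inward_normal_segment np nq pq cx nx'.
have I2 := inward_normal_segment np nr pr cx nx'.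
have [Z0 W0] := vertex_zw_neq0 hsig np nq nr pq pr cx.
have := vertex_sign hsig np nq nr pq pr V cx; rewrite nmulr_lgt0 // => S0.
move: I1 I2 Z0 W0 S0; move: (h x q * h q p) (h x r * h r p) => Z W I1 I2 Z0 W0 S0.
set mz := Num.sqrt (sqn Z) in I1; set mw := Num.sqrt (sqn W) in I2.
set n := Num.sqrt (- nrm x) in I1 I2.
have mz0 : 0 < mz by rewrite sqrtr_gt0 sqn_gt0.
have mw0 : 0 < mw by rewrite sqrtr_gt0 sqn_gt0.
have mzE : mz ^+ 2 = sqn Z by rewrite sqr_sqrtr // sqn_ge0.
have mwE : mw ^+ 2 = sqn W by rewrite sqr_sqrtr // sqn_ge0.
clearbody mz mw; pose S := Z * W^*; pose m := mz * mw.
have m0 : 0 < m by rewrite mulr_gt0.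
have SE : re S ^+ 2 + im S ^+ 2 = m ^+ 2.
  by rewrite exprMn mzE mwE -(sqn_conj W) -sqnM.
pose cs := re S / m; pose sn := - im S / m.
have sn0 : 0 < sn by rewrite divr_gt0 ?oppr_gt0.
have cs2 : cs ^+ 2 + sn ^+ 2 = 1.
  by rewrite /cs /sn !expr_div_n sqrrN -mulrDl SE divff // expf_neq0 ?gt_eqF.
have sn2 : 0 < sn ^+ 2 by rewrite exprn_gt0.
have cs1 : cs ^+ 2 < 1 ^+ 2 by rewrite expr1n; lra.
have /andP[csl csr] : -1 < cs < 1.
  by rewrite -ltr_norml -(@ltr_pXn2r _ 2) ?nnegrE ?normr_ge0 // real_normK ?num_real.
have t0 : 0 < acos cs by rewrite acos_gt0 // (ltW csl) csr.
have tpi : acos cs < pi by rewrite acos_ltpi // csl (ltW csr).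
have csb : -1 <= cs <= 1 by rewrite !ltW.
have ct : cos (acos cs) = cs by rewrite acosK // in_itv.
have st : sin (acos cs) = sn.
  rewrite sin_acos // (_ : 1 - cs ^+ 2 = sn ^+ 2); last by lra.
  by rewrite sqrtr_sqr gtr0_norm.
exists (acos cs); first by rewrite t0.
split; first by rewrite (ltW t0) /= (lt_trans tpi) // ltr_pMl ?pi_gt0 // ltr1n.
eexists; eexists; split; [exact: I1|exact: I2|].
rewrite scalerA; congr (_ *: _); rewrite ct st mulrN; congr (- _).
have -> : (cs +i* sn)%C = (m^-1)%:C%C * S^* :> Cplx R.
  by rewrite /cs /sn; case: (S) => s1 s2; apply: complex_eq => /=; ring.
have -> : (m^-1)%:C%C * S^* * ((n / mz)%:C%C * Z) =
    (m^-1 * (n / mz) * mz ^+ 2)%:C%C * W.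
  by rewrite mzE !realCM -mulC_conj /S rmorphM /= conjCK; ring.
by congr (_%:C%C * _); rewrite /m; field; rewrite !gt_eqF.
Qed.

End VertexConditions.

(** * Volume forms in coordinates *)

Lemma det_matrix33 (S : comNzRingType) (F : nat -> nat -> S) :
  \det (\matrix_(i < 3, j < 3) F i j) =
    F 0 0 * (F 1 1 * F 2 2 - F 1 2 * F 2 1)
    - F 0 1 * (F 1 0 * F 2 2 - F 1 2 * F 2 0)
    + F 0 2 * (F 1 0 * F 2 1 - F 1 1 * F 2 0) :> S.
Proof.
rewrite (expand_det_row _ ord0) !big_ord_recl big_ord0 /cofactor.
rewrite !(expand_det_row _ ord0) !big_ord_recl !big_ord0 /cofactor !det_mx11 !mxE /=.
by rewrite /bump /=; ring.
Qed.

Section Volume.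
Variables (R : realType) (k : Cplx R).
Implicit Types (x y z : vec R) (a b c d : Cplx R).

(** Existential indices hide the ordinals, so that [ring] sees only nine atoms. *)
Lemma vol_coordinates : exists i j l : 'I_3, forall x y z, vol k x y z =
  k * (x 0 i * (y 0 j * z 0 l - y 0 l * z 0 j)
    - x 0 j * (y 0 i * z 0 l - y 0 l * z 0 i)
    + x 0 l * (y 0 i * z 0 j - y 0 j * z 0 i)).
Proof.
exists (inord 0), (inord 1), (inord 2) => x y z; rewrite /vol; congr (_ * _).
pose F (i j : nat) : Cplx R :=
  nth 0 [:: x 0 (inord j); y 0 (inord j); z 0 (inord j)] i.
transitivity (\det (\matrix_(i < 3, j < 3) F i j)); last by rewrite det_matrix33.
congr (\det _); apply/matrixP => i j; rewrite !mxE /F.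
case: splitP => [i' ->|i' ->]; first by rewrite ord1 inord_val.
by rewrite mxE; case: splitP => [l ->|l ->]; rewrite !ord1 /= inord_val.
Qed.

Lemma volZ a x y z : vol k (a *: x) y z = a * vol k x y z.
Proof. by have [i [j [l E]]] := vol_coordinates; rewrite !E !mxE; ring. Qed.

Lemma vol_combine_outer a b c d x y z :
  vol k (a *: z + b *: x) y (c *: z + d *: x) = (b * c - a * d) * vol k x y z.
Proof.
have [i [j [l E]]] := vol_coordinates; rewrite !E !mxE.
move: (x 0 i) (x 0 j) (x 0 l) (y 0 i) (y 0 j) (y 0 l) (z 0 i) (z 0 j) (z 0 l).
by move=> x1 x2 x3 y1 y2 y3 z1 z2 z3; ring.
Qed.

Lemma vol_combine_last a b c d x y z :
  vol k x (a *: y + b *: z) (c *: z - d *: y) = (a * c + b * d) * vol k x y z.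
Proof.
have [i [j [l E]]] := vol_coordinates; rewrite !E !mxE.
move: (x 0 i) (x 0 j) (x 0 l) (y 0 i) (y 0 j) (y 0 l) (z 0 i) (z 0 j) (z 0 l).
by move=> x1 x2 x3 y1 y2 y3 z1 z2 z3; ring.
Qed.

End Volume.

(** * Polar form of complex numbers *)

Section Polar.
Variable R : realType.

Definition cis (t : R) : Cplx R := (cos t +i* sin t)%C.

Lemma cis_conj t : cis t * (cis t)^* = 1.
Proof. by rewrite mulC_conj /sqn /= cos2Dsin2. Qed.

Lemma cis0 : cis 0 = 1.
Proof. by rewrite /cis cos0 sin0. Qed.

Lemma polarE (z : Cplx R) : z != 0 ->
  exists t : R, z = (Num.sqrt (sqn z))%:C%C * cis t.
Proof.
rewrite -sqn_gt0 => z0; set m := Num.sqrt _.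
have m0 : 0 < m by rewrite sqrtr_gt0.
have mE : m ^+ 2 = sqn z by rewrite sqr_sqrtr // ltW.
clearbody m; case: z z0 mE => x y; rewrite /sqn /= => z0 mE.
have c2 : (x / m) ^+ 2 + (y / m) ^+ 2 = 1.
  by rewrite !expr_div_n -mulrDl -mE divff // expf_neq0 ?gt_eqF.
have cb : -1 <= x / m <= 1.
  rewrite -ler_norml -(@ler_pXn2r _ 2) ?nnegrE ?normr_ge0 // real_normK ?num_real //.
  by have := sqr_ge0 (y / m); rewrite expr1n; lra.
have ct : cos (acos (x / m)) = x / m by rewrite acosK // in_itv.
have st : sin (acos (x / m)) = `|y / m|.
  by rewrite sin_acos // (_ : 1 - (x / m) ^+ 2 = (y / m) ^+ 2) ?sqrtr_sqr //; lra.
have [y0|y0] := lerP 0 (y / m).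
  exists (acos (x / m)); rewrite /cis ct st ger0_norm //.
  by apply: complex_eq => /=; field; rewrite gt_eqF.
exists (- acos (x / m)); rewrite /cis cosN sinN ct st ltr0_norm // opprK.
by apply: complex_eq => /=; field; rewrite gt_eqF.
Qed.

Lemma cvg_cis (F : set_system R) {FF : Filter F} (f : R -> R) (a : R) :
  f @ F --> a -> (fun t => cis (f t)) @ F --> cis a.
Proof.
move=> fa.
have E (t : R) : cis t = (cos t)%:C%C + 'i%C * (sin t)%:C%C.
  by rewrite /cis; apply: complex_eq => /=; ring.
have C : (fun t => (cos (f t))%:C%C : Cplx R) @ F --> ((cos a)%:C%C : Cplx R).
  apply: cvg_realC; exact: cvg_comp fa (@continuous_cos R a).
have S : (fun t => (sin (f t))%:C%C : Cplx R) @ F --> ((sin a)%:C%C : Cplx R).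
  apply: cvg_realC; exact: cvg_comp fa (@continuous_sin R a).
rewrite E; under eq_fun do rewrite E.
exact: (cvgD C (cvgM (cvg_cst ('i%C : Cplx R)) S)).
Qed.

End Polar.

(** * Deforming an oriented frame until its last vector is a prescribed one *)

Section Frames.
Variable R : realType.
Variable h : herm R.
Local Notation nrm := (hnorm h).
Local Notation tau := (tance h).
Implicit Types (x y z u v w c f p q : vec R).

(** An SU(2) rotation of y, z by (t, s), followed by an element (a, b) of SU(1,1) acting on x and
    the rotated z; both have determinant 1. *)
Lemma pos_orthonormal_combine (k a b s t : Cplx R) x y z :
  orthonormal h x y z -> vol k x y z = 1 ->
  b * b^* - a * a^* = 1 -> t * t^* + s * s^* = 1 ->
  pos_orthonormal h k (a *: (t^* *: z - s^* *: y) + b *: x) (t *: y + s *: z)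
    (b^* *: (t^* *: z - s^* *: y) + a^* *: x).
Proof.
move=> [[xx yy zz] [xy xz yz]] V ba ts; split; last first.
  by rewrite vol_combine_outer vol_combine_last ba ts V !mulr1.
have yx := h_eq0C xy; have zx := h_eq0C xz; have zy := h_eq0C yz.
set u := t^* *: z - s^* *: y; set p := t *: y + s *: z.
have uu : h u u = 1.
  by rewrite /u !hE yy zz yz zy !conjCK -[RHS]ts; ring.
have pp : h p p = 1 by rewrite /p !hE yy zz yz zy -[RHS]ts; ring.
have up : h u p = 0 by rewrite /u /p !hE yy zz yz zy; ring.
have ux : h u x = 0 by rewrite /u !hE yx zx; ring.
have px : h p x = 0 by rewrite /p !hE yx zx; ring.
have xu := h_eq0C ux; have xp := h_eq0C px; have pu := h_eq0C up.
clearbody u p; split; split; rewrite ?pp // !hE ?uu ?xx ?xu ?ux ?xp ?up ?pu ?px ?conjCK.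
- by transitivity (- (b * b^* - a * a^*)); [ring|rewrite ba].
- by transitivity (b * b^* - a * a^*); [ring|rewrite ba].
- by ring.
- by ring.
- by ring.
Qed.

(* An element of SU(1,1), read off from two positively oriented frames with the
   same middle vector. *)
Lemma frame_change (k : Cplx R) c p q x z :
  pos_orthonormal h k c p q -> pos_orthonormal h k x p z ->
  exists a b : Cplx R, [/\ b * b^* - a * a^* = 1,
    c = a *: z + b *: x & q = b^* *: z + a^* *: x].
Proof.
move=> [[[cc pp qq] [cp cq pq]] V] [fr V2].
have [[xx _ zz] [xp xz pz]] := fr.
have cE : c = h c z *: z + (- h c x) *: x.
  by have := orthonormal_expand c fr; rewrite cp scale0r addr0 addrC.
have qE : q = h q z *: z + (- h q x) *: x.
  by have := orthonormal_expand q fr; rewrite (h_eq0C pq) scale0r addr0 addrC.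
move: (h c z) (- h c x) (h q z) (- h q x) cE qE => a b d e cE qE.
have zx := h_eq0C xz.
have q1 : d * d^* - e * e^* = 1 by rewrite -qq qE !hE xx zz xz zx; ring.
have c1 : a * d^* - b * e^* = 0 by rewrite -cq cE qE !hE xx zz xz zx; ring.
have v1 : b * d - a * e = 1.
  by rewrite -V cE qE vol_combine_outer V2 mulr1.
have bE : b = d^*.
  have -> : b = b * (d * d^* - e * e^*) by rewrite q1 mulr1.
  have -> : b * (d * d^* - e * e^*) =
    d^* * (b * d - a * e) + e * (a * d^* - b * e^*) by ring.
  by rewrite v1 c1 mulr0 addr0 mulr1.
have aE : a = e^*.
  have -> : a = a * (d * d^* - e * e^*) by rewrite q1 mulr1.
  have -> : a * (d * d^* - e * e^*) =
    e^* * (b * d - a * e) + d * (a * d^* - b * e^*) by ring.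
  by rewrite v1 c1 mulr0 addr0 mulr1.
exists a, b; split; [|exact: cE|by rewrite bE aE !conjCK].
by rewrite bE aE !conjCK -q1; ring.
Qed.

Lemma cvg_sqrt (F : set_system R) {FF : Filter F} (g : R -> R) (m : R) :
  g @ F --> m -> (fun t => Num.sqrt (g t)) @ F --> Num.sqrt m.
Proof. by move=> gm; exact: cvg_comp gm (@sqrt_continuous R m). Qed.

Section FramePath.
Variables (k : Cplx R) (c p q f : vec R).
Hypothesis hk : normalized_vol h k.
Hypothesis o : pos_orthonormal h k c p q.
Hypothesis nf : nrm f = 1.
Hypothesis N1 : sqn (h p f) < 1.

Local Notation N := (sqn (h p f)).

(** As N < 1, the component of p orthogonal to f is positive and yields y, while the vector
    orthogonal to both p and f has norm N - 1 < 0 and yields x; a phase on x then normalizes the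
    volume. *)
Lemma adapted_frame : exists x y, [/\ orthonormal h x y f, vol k x y f = 1 &
  p = (Num.sqrt (1 - N))%:C%C *: y + h p f *: f].
Proof.
have [fr _] := o; have [nc np nq] := orthonormal_nrm fr.
have pp := nrm_unit_h np; have ff := nrm_unit_h nf.
have m0 : 0 < 1 - N by rewrite subr_gt0.
have s0 : Num.sqrt (1 - N) != 0 by rewrite gt_eqF // sqrtr_gt0.
pose y1 := p - h p f *: f.
have y1f : h y1 f = 0 by rewrite /y1 hDl hNl hZl ff mulr1 subrr.
have ny1 : nrm y1 = 1 - N.
  by rewrite /y1 nrmD -scaleN1r !nrmZ np nf !hZr /sqn !reimE; ring.
have [Fp Ff nF _] := orth_complement f fr.
set F := _ - _ in Fp Ff nF.
have {}nF : nrm F = - (1 - N) by rewrite nF nf -(sqn_conj (h f p)) -hC opprB.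
have Fy1 : h F y1 = 0 by rewrite /y1 hDr hNr hZr Fp Ff mulr0 oppr0 addr0.
pose y := (Num.sqrt (1 - N))^-1%:C%C *: y1.
pose x1 := (Num.sqrt (1 - N))^-1%:C%C *: F.
have o2 : orthonormal h x1 y f.
  split; first by rewrite !hxx nf (nrm_negunit m0) // (nrm_unit m0) // realCN.
  by rewrite /x1 /y !(hZl, hZr) Fy1 Ff y1f !mulr0.
have V1 : sqn (vol k x1 y f) = 1 by apply: sqn_norm1; exact: hk.
have yE : (Num.sqrt (1 - N))%:C%C *: y + h p f *: f = p.
  by rewrite /y scalerA -realCM divff // [1%:C%C *: _]scale1r subrK.
clearbody x1 y; exists ((vol k x1 y f)^* *: x1), y; split => //.
  case: o2 => -[xx yy _] [xy xf yf]; split; split => //; rewrite !(hZl, hZr).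
  - by rewrite conjCK xx mulrA (mulrC _^*) mulC_conj V1 mul1r.
  - by rewrite xy mulr0.
  - by rewrite xf mulr0.
by rewrite volZ mulrC mulC_conj V1.
Qed.

(* The component of p along f is rotated away in span(p, f), while the resulting
   SU(1,1)-rotation of (c, q) is contracted to the identity. *)
Lemma frame_path : exists cc pp qq : R -> vec R,
  [/\ [/\ continuous cc, continuous pp & continuous qq],
      [/\ cc 0 = c, pp 0 = p & qq 0 = q],
      (forall d : R, 0 <= d <= 1 -> pos_orthonormal h k (cc d) (pp d) (qq d)),
      (forall d : R, 0 <= d <= 1 -> exists2 s : R, 1 <= s &
         forall u, h f u = 0 -> h (pp d) u = s%:C%C * h p u) &
      [/\ (h p f = 0 -> forall d, pp d = p), h (pp 1) f = 0 & qq 1 = f]].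
Proof.
have [x [y [xyf V pE]]] := adapted_frame.
have N0 : 0 <= N by exact: sqn_ge0.
pose t0 : Cplx R := (Num.sqrt (1 - N))%:C%C.
have tt0 : t0 * t0^* + h p f * (h p f)^* = 1.
  rewrite !mulC_conj sqn_real sqr_sqrtr ?subr_ge0 ?ltW //.
  by rewrite -realCD subrK.
have [a0 [b0 [ba cE qE]]] : exists a b : Cplx R, [/\ b * b^* - a * a^* = 1,
    c = a *: (t0^* *: f - (h p f)^* *: y) + b *: x &
    q = b^* *: (t0^* *: f - (h p f)^* *: y) + a^* *: x].
  apply: (frame_change o).
  have ba01 : (1 : Cplx R) * 1^* - 0 * 0^* = 1 by rewrite conjC1 conjC0; ring.
  have := pos_orthonormal_combine xyf V ba01 tt0.
  by rewrite conjC1 conjC0 !scale0r !scale1r add0r addr0 -pE.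
have bb : sqn b0 = 1 + sqn a0.
  have := congr1 (@complex.Re R) ba; rewrite !mulC_conj reD reN !reC => e; lra.
have [|phi bE] := @polarE R b0.
  by rewrite -sqn_gt0 bb ltr_wpDr ?sqn_ge0.
(* The component along f shrinks linearly, so [rho] grows from sqrt(1 - N) to 1; the scaling factor
   is [rho d] divided by its initial value. *)
pose rho d : R := Num.sqrt (1 - (1 - d) ^+ 2 * N).
pose t d : Cplx R := (rho d)%:C%C.
pose s d : Cplx R := (1 - d)%:C%C * h p f.
pose a d : Cplx R := (1 - d)%:C%C * a0.
(* The modulus is forced by |b|^2 - |a|^2 = 1 and never vanishes; the phase unwinds linearly to
   0. *)
pose b d : Cplx R := (Num.sqrt (1 + (1 - d) ^+ 2 * sqn a0))%:C%C * cis ((1 - d) * phi).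
pose u d : vec R := (t d)^* *: f - (s d)^* *: y.
have c1 : continuous (fun d : R => 1 - d).
  by move=> d; exact: (cvgB (cvg_cst (1 : R)) cvg_id).
have c2 M : continuous (fun d : R => (1 - d) ^+ 2 * M : R).
  by move=> d; exact: (cvgM (cvgM (c1 d) (c1 d)) (cvg_cst M)).
have ct d : t @ d --> t d.
  exact: (cvg_realC (cvg_sqrt (cvgB (cvg_cst (1 : R)) (c2 N d)))).
have cs d : s @ d --> s d.
  exact: (cvgM (cvg_realC (c1 d)) (cvg_cst (h p f : Cplx R))).
have ca d : a @ d --> a d.
  exact: (cvgM (cvg_realC (c1 d)) (cvg_cst (a0 : Cplx R))).
have cb d : b @ d --> b d.
  have R1 : (fun d => Num.sqrt (1 + (1 - d) ^+ 2 * sqn a0)) @ d -->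
      Num.sqrt (1 + (1 - d) ^+ 2 * sqn a0).
    exact: (cvg_sqrt (cvgD (cvg_cst (1 : R)) (c2 (sqn a0) d))).
  have R2 : (fun d => cis ((1 - d) * phi)) @ d --> cis ((1 - d) * phi).
    apply: cvg_cis; exact: (cvgM (c1 d) (cvg_cst phi)).
  exact: (cvgM (cvg_realC R1) R2).
have cu d : u @ d --> u d.
  exact: (cvgB (cvgZ (cvg_conj (ct d)) (cvg_cst f)) (cvgZ (cvg_conj (cs d)) (cvg_cst y))).
exists (fun d => a d *: u d + b d *: x), (fun d => t d *: y + s d *: f).
exists (fun d => (b d)^* *: u d + (a d)^* *: x); split.
- split => d.
  + exact: (cvgD (cvgZ (ca d) (cu d)) (cvgZ (cb d) (cvg_cst x))).
  + exact: (cvgD (cvgZ (ct d) (cvg_cst y)) (cvgZ (cs d) (cvg_cst f))).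
  + exact: (cvgD (cvgZ (cvg_conj (cb d)) (cu d)) (cvgZ (cvg_conj (ca d)) (cvg_cst x))).
- have t00 : t 0 = t0 by rewrite /t /rho subr0 expr1n mul1r.
  have s00 : s 0 = h p f by rewrite /s subr0 [1%:C%C * _]mul1r.
  have a00 : a 0 = a0 by rewrite /a subr0 [1%:C%C * _]mul1r.
  have b00 : b 0 = b0.
    by rewrite /b subr0 expr1n !mul1r -bb [RHS]bE.
  by rewrite /u t00 s00 a00 b00 -cE -qE -pE.
- move=> d /andP[d0 d1]; apply: pos_orthonormal_combine => //.
    rewrite /b /a rmorphM /= [_ * cis _ * _]mulrACA cis_conj mulr1 !mulC_conj.
    rewrite sqnM !sqn_real sqr_sqrtr -?realCN -?realCD ?addrK //.
    by rewrite addr_ge0 // mulr_ge0 ?sqr_ge0 ?sqn_ge0.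
  rewrite !mulC_conj sqnM !sqn_real sqr_sqrtr -?realCD ?subrK //.
  rewrite subr_ge0; have := ltW N1; nra.
- move=> d /andP[d0 d1]; have m0 : 0 < Num.sqrt (1 - N) by rewrite sqrtr_gt0 subr_gt0.
  exists (rho d / Num.sqrt (1 - N)).
    rewrite ler_pdivlMr // mul1r /rho ler_wsqrtr // lerD2l lerN2 ler_piMl //.
    by rewrite exprn_ile1 ?subr_ge0 // lerBlDr lerDl.
  move=> w fw; have pw : h p w = t0 * h y w.
    by rewrite {1}pE hDl !hZl fw mulr0 addr0.
  by rewrite pw hDl !hZl fw mulr0 addr0 mulrA -realCM divfK ?gt_eqF.
- have s1 : s 1 = 0 by rewrite /s subrr [0%:C%C * _]mul0r.
  have a1 : a 1 = 0 by rewrite /a subrr [0%:C%C * _]mul0r.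
  have t1 : t 1 = 1 by rewrite /t /rho subrr expr0n mul0r subr0 sqrtr1.
  have b1 : b 1 = 1 by rewrite /b subrr expr0n !mul0r addr0 sqrtr1 cis0 mulr1.
  split.
  + move=> pf d; rewrite [RHS]pE /s pf mulr0 !scale0r !addr0 /t /rho pf.
    by congr (_%:C%C *: _); rewrite /sqn /= !expr0n addr0 mulr0.
  + by rewrite s1 t1 scale0r addr0 scale1r; case: xyf => _ [].
  + rewrite /u s1 t1 a1 b1 conjC1 conjC0 !scale0r !scale1r subr0.
    by rewrite addr0.
Qed.

End FramePath.

End Frames.

(** * Stability of the triangle conditions under scaling *)

Section Triangles.
Variable R : realType.
Implicit Types (a b c x s : R).

Lemma vertex_condC a b x : vertex_cond a b x <-> vertex_cond b a x.
Proof. by rewrite /vertex_cond (mulrC b a) (mulrC (b - 1)). Qed.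

(** The condition gives x > ab - sqrt(ab(a-1)(b-1)), and by AM-GM for a(b-1) and b(a-1) the root is
    at most ab - (a+b)/2. *)
Lemma vertex_cond_sum_lt a b x : 1 < a -> 1 < b -> vertex_cond a b x ->
  a + b < 2 * x.
Proof.
rewrite /vertex_cond => a1 b1 V; rewrite ltNge; apply/negP => xle.
have ab : 0 <= 2 * (a * b) - (a + b) by nra.
have : 0 <= (a + b - 2 * x) * (4 * (a * b) - (a + b) - 2 * x).
  by rewrite mulr_ge0 ?subr_ge0 //; lra.
have := sqr_ge0 (a - b); nra.
Qed.

(** In the form x^2 - ab < ab(2x - a - b), scaling multiplies the left side by s^2 and the positive
    right side by s^3. *)
Lemma vertex_cond_scale2 a b x s : 1 < a -> 1 < b -> 1 <= s ->
  vertex_cond a b x -> vertex_cond (s * a) (s * b) (s * x).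
Proof.
move=> a1 b1 s1 V; have S := vertex_cond_sum_lt a1 b1 V.
have ab : 0 < a * b by rewrite mulr_gt0 // (lt_trans ltr01).
have s0 : 0 < s by rewrite (lt_le_trans ltr01).
move: V; rewrite /vertex_cond => V.
have V1 : x ^+ 2 - a * b < a * b * (2 * x - a - b) by move: V; lra.
have V2 : x ^+ 2 - a * b < s * (a * b * (2 * x - a - b)).
  have P : 0 < a * b * (2 * x - a - b) by rewrite mulr_gt0 //; lra.
  by rewrite (lt_le_trans V1) // ler_peMl // ltW.
have : s ^+ 2 * (x ^+ 2 - a * b) < s ^+ 2 * (s * (a * b * (2 * x - a - b))).
  by rewrite ltr_pM2l // exprn_gt0.
lra.
Qed.

(** The square gains the factor s^2, and the right side gains at least as much because s a - 1 >= s
    (a - 1). *)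
Lemma vertex_cond_scale1 a c x s : 1 < a -> 1 < c -> 1 <= s ->
  vertex_cond a c x -> vertex_cond (s * a) c (s * x).
Proof.
rewrite /vertex_cond => a1 c1 s1 V.
have s0 : 0 < s by rewrite (lt_le_trans ltr01).
have ac : 0 < a * c * (c - 1).
  by rewrite mulr_gt0 ?subr_gt0 // mulr_gt0 // (lt_trans ltr01).
have V1 : s * (x - a * c) ^+ 2 < s * (a * c * ((a - 1) * (c - 1))) by rewrite ltr_pM2l.
have V2 : 0 <= (s - 1) * (a * c * (c - 1)) by rewrite mulr_ge0 ?subr_ge0 // ltW.
have V3 : s * (x - a * c) ^+ 2 < a * c * ((s * a - 1) * (c - 1)) by move: V1 V2; lra.
have : s * (s * (x - a * c) ^+ 2) < s * (a * c * ((s * a - 1) * (c - 1))).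
  by rewrite ltr_pM2l.
lra.
Qed.

Variable h : herm R.
Hypothesis hsig : signature_mpp h.
Local Notation nrm := (hnorm h).
Local Notation tau := (tance h).
Local Notation bform := (bform h).
Local Notation kappa := (gram3 h).
Implicit Types (y u v w f p q r : vec R).

Definition triangle_cond p q r : Prop :=
  [/\ vertex_cond (tau p q) (tau p r) (re (kappa p q r)),
      vertex_cond (tau p q) (tau q r) (re (kappa p q r)),
      vertex_cond (tau p r) (tau q r) (re (kappa p q r)) &
      im (kappa p q r) < 0].

Lemma triangle_condP p q r : nrm p = 1 -> nrm q = 1 -> nrm r = 1 ->
  1 < tau p q -> 1 < tau p r -> 1 < tau q r ->
  transversal_triangle h p q r /\ ccw_triangle h p q r <-> triangle_cond p q r.
Proof.
move=> np nq nr pq pr qr.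
have qp : 1 < tau q p by rewrite tauC.
have rp : 1 < tau r p by rewrite tauC.
have rq : 1 < tau r q by rewrite tauC.
have Tp := transversal_vertexP hsig np nq nr pq pr.
have Tq := transversal_vertexP hsig nq nr np qr qp.
have Tr := transversal_vertexP hsig nr np nq rp rq.
rewrite kappa_rot (tauC _ q p) in Tq.
rewrite kappa_rot kappa_rot (tauC _ r p) (tauC _ r q) in Tr.
have C := ccw_triangleP hsig np nq nr pq pr.
split=> [[[/Tp V1 /Tq V2 /Tr V3] ccw]|[V1 V2 V3 k0]].
  by split=> //; [exact/vertex_condC|exact/(C V1)].
split; last exact/(C V1).
by split; [exact/Tp|exact/Tq/vertex_condC|exact/Tr].
Qed.

Lemma tau_scale p p' q s : h p' q = s%:C%C * h p q -> tau p' q = s ^+ 2 * tau p q.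
Proof. by move=> e; rewrite /tance e sqnM sqn_real. Qed.

(** Tances at p and the triple product gain s^2. At p both tances are scaled, at q and r only one
    is, whence two scaling lemmas. *)
Lemma triangle_cond_scale p p' q r s : 1 <= s ->
  1 < tau p q -> 1 < tau p r -> 1 < tau q r ->
  h p' q = s%:C%C * h p q -> h p' r = s%:C%C * h p r ->
  triangle_cond p q r -> triangle_cond p' q r.
Proof.
move=> s1 pq pr qr eq er [V1 V2 V3 k0].
have s2 : 1 <= s ^+ 2 by rewrite exprn_ege1.
have kE : kappa p' q r = (s ^+ 2)%:C%C * kappa p q r.
  rewrite /gram3 (hC r p') eq er rmorphM /= conjC_real -hC realCM; ring.
rewrite /triangle_cond (tau_scale eq) (tau_scale er) kE.
have -> : re ((s ^+ 2)%:C%C * kappa p q r) = s ^+ 2 * re (kappa p q r).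
  by rewrite reM reC imC mul0r subr0.
split; [exact: vertex_cond_scale2|exact: vertex_cond_scale1|exact: vertex_cond_scale1|].
by rewrite imM reC imC mul0r addr0 pmulr_rlt0 // (lt_le_trans ltr01).
Qed.

(* The projection of p to f^\bot = span(q, r) has norm
   (2 x - a - b) / (ta(q, r) - 1). *)
Lemma polar_component_lt1 p q r f : nrm p = 1 -> nrm q = 1 -> nrm r = 1 ->
  nrm f = 1 -> h f q = 0 -> h f r = 0 -> 1 < tau p q -> 1 < tau p r ->
  1 < tau q r -> vertex_cond (tau p q) (tau p r) (re (kappa p q r)) ->
  sqn (h p f) < 1.
Proof.
move=> np nq nr nf fq fr pq pr qr V; have S := vertex_cond_sum_lt pq pr V.
have qq := nrm_unit_h nq; have ff := nrm_unit_h nf.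
(* The vectors n, q, f form an orthogonal basis, with <n,n> = 1 - ta(q, r) < 0. *)
pose n := r - h r q *: q.
have nq0 : h n q = 0 by rewrite /n hDl hNl hZl qq mulr1 subrr.
have nf0 : h n f = 0.
  by rewrite /n hDl hNl hZl (h_eq0C fq) (h_eq0C fr) mulr0 oppr0 addr0.
have nn : nrm n = 1 - tau q r.
  rewrite /n nrmD -scaleN1r !nrmZ nq nr !hZr tauC /tance /sqn !reimE; ring.
have pn : sqn (h p n) =
    tau p r + tau p q * tau q r - 2 * re (kappa p q r).
  rewrite /n hDr hNr hZr -hC /tance /gram3 (hC r p).
  by move: (h p r) (h q r) (h p q) => u v w; rewrite /sqn !reimE; ring.
clearbody n.
have n0 : nrm n != 0 by rewrite nn subr_eq0 lt_eqF.
have pE := orthogonal_expand (h := h) p n0 _ _ nq0 nf0 (h_eq0C fq).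
have {}pE := pE (ltac:(by rewrite nq oner_eq0)) (ltac:(by rewrite nf oner_eq0)).
have : nrm p = sqn (h p n) / nrm n + tau p q + sqn (h p f).
  rewrite {1}/hnorm {2}pE !hDr !hZr qq ff !divr1 /tance.
  have -> : (h p n / h n n)^* * h p n = (sqn (h p n) / nrm n)%:C%C.
    rewrite hxx rmorphM /= mulrAC (mulrC _^*) mulC_conj.
    by rewrite realCM -{1}(conjC_real (nrm n)) -fmorphV conjCK [in RHS]fmorphV.
  by rewrite (mulrC _^* (h p q)) (mulrC _^* (h p f)) !mulC_conj -!realCD.
rewrite np pn nn => e.
have c0 : 0 < tau q r - 1 by rewrite subr_gt0.
have : (1 - sqn (h p f)) * (tau q r - 1) = 2 * re (kappa p q r) - tau p q - tau p r.
  rewrite {1}e; field; rewrite subr_eq0 lt_eqF //.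
move=> E; have : 0 < (1 - sqn (h p f)) * (tau q r - 1) by rewrite E; lra.
by rewrite pmulr_lgt0 // subr_gt0.
Qed.

(** At a common point both T for (q, r) and T for (r, q) would have negative imaginary part, but
    they are conjugate. *)
Lemma triangle_cond_separates p p' q r : nrm p = 1 -> nrm p' = 1 ->
  nrm q = 1 -> nrm r = 1 -> 1 < tau p q -> 1 < tau p r -> 1 < tau p' q ->
  1 < tau p' r -> 1 < tau q r -> triangle_cond p q r -> triangle_cond p' r q ->
  1 < tau p p'.
Proof.
move=> np np' nq nr pq pr p'q p'r qr [_ V _ k0] [_ V' _ k0'].
apply: (disjoint_tau_gt1 hsig np np'); apply/seteqP; split=> // x [cx cx'].
have := opposite_side_sign hsig np nq nr pq pr qr V k0 cx.
have := opposite_side_sign hsig np' nr nq p'r p'q _ V' k0' cx'.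
by rewrite tauC bformC im_conj => /(_ qr); lra.
Qed.

Lemma unitary_unitmx (A : 'M[Cplx R]_3) : unitary h A -> A \in unitmx.
Proof.
move=> U; rewrite -row_free_unit; apply: inj_row_free => v vA.
have [e0 [e1 [e2 e]]] := hsig.
have v0 w : h v w = 0 by rewrite -U vA h0l.
by rewrite (orthonormal_expand v e) !v0 oppr0 !scale0r !addr0.
Qed.

Lemma unitary_nrm A v : unitary h A -> nrm (v *m A) = nrm v.
Proof. by move=> U; rewrite /hnorm U. Qed.

Lemma fixes_unit A p : unitary h A -> nrm p = 1 -> fixes A p ->
  exists2 a : Cplx R, sqn a = 1 & p *m A = a *: p.
Proof.
move=> U np [a e]; exists a => //.
by have := unitary_nrm p U; rewrite e nrmZ np mulr1.
Qed.

Lemma fixes_tau A p v : unitary h A -> nrm p = 1 -> fixes A p ->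
  tau p (v *m A) = tau p v.
Proof.
move=> U np /(fixes_unit U np)[a a1 e].
by rewrite /tance -(U p v) e hZl sqnM a1 mul1r.
Qed.

Lemma tau_same_point p q v : nrm q = 1 -> nrm v = 1 -> same_point q v ->
  tau p q = tau p v.
Proof.
move=> nq nv [a _ e]; move: nq; rewrite e nrmZ nv mulr1 => a1.
by rewrite /tance hZr sqnM sqn_conj a1 mul1r.
Qed.

End Triangles.

(** * Deformation of the quadrangle to a common focus *)

Theorem lemma28 (R : realType) (h : herm R) (hsig : signature_mpp h)
  (k : Cplx R) (hk : normalized_vol h k)
  (n1 n2 n3 : nat) (hn1 : (0 < n1)%N) (hn2 : (0 < n2)%N) (hn3 : (0 < n3)%N)
  (hn : (n1%:R)^-1 + (n2%:R)^-1 + (n3%:R)^-1 < 1 :> R)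
  (A1 A2 A3 : 'M[Cplx R]_3) (hrep : triangle_rep h n1 n2 n3 A1 A2 A3)
  (c p q : 'I_4 -> vec R)
  (hbasis : forall i, pos_orthonormal h k (c i) (p i) (q i))
  (hfix1 : fixes A1 (c i1) /\ fixes A1 (p i1))
  (hfix2 : fixes A2 (c i2) /\ fixes A2 (p i2))
  (hfix3 : fixes A3 (c i3) /\ fixes A3 (p i3))
  (hc4 : same_point (c i4) (c i2 *m invmx A1))
  (hp4 : same_point (p i4) (p i2 *m invmx A1))
  (hQ : quadrangle_conditions h n1 n2 n3 c p) :
  exists cc pp qq : 'I_4 -> R -> vec R,
    [/\ (forall i, [/\ {within `[0, 1], continuous (cc i)},
                       {within `[0, 1], continuous (pp i)} &
                       {within `[0, 1], continuous (qq i)}]),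
        (forall i, [/\ cc i 0 = c i, pp i 0 = p i & qq i 0 = q i]) &
     [/\ (forall i (d : R), 0 <= d <= 1 ->
           pos_orthonormal h k (cc i d) (pp i d) (qq i d)),
         (forall i j (d : R), i != j -> 0 <= d <= 1 ->
           1 < ta h (pp i d) (pp j d)),
         (forall d : R, 0 <= d <= 1 ->
           [/\ transversal_triangle h (pp i1 d) (pp i2 d) (pp i4 d),
               ccw_triangle h (pp i1 d) (pp i2 d) (pp i4 d),
               transversal_triangle h (pp i3 d) (pp i4 d) (pp i2 d) &
               ccw_triangle h (pp i3 d) (pp i4 d) (pp i2 d)]),
         [/\ qq i1 1 = qq i2 1, qq i2 1 = qq i3 1 & qq i3 1 = qq i4 1] &
         exists f, [/\ bisector_focus h (pp i1 1) (pp i2 1) f,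
                       bisector_focus h (pp i2 1) (pp i3 1) f,
                       bisector_focus h (pp i3 1) (pp i4 1) f &
                       bisector_focus h (pp i4 1) (pp i1 1) f]]].
Proof.
have [[U1 U2 U3] _ _ Msc _] := hrep.
have [[u12 u32 u24] [T1 T3] _ _] := hQ.
have nc i : hnorm h (p i) = 1 by case: (hbasis i) => /orthonormal_nrm[].
have t12 := disjoint_tau_gt1 hsig (nc i1) (nc i2) u12.
have t32 := disjoint_tau_gt1 hsig (nc i3) (nc i2) u32.
have t24 := disjoint_tau_gt1 hsig (nc i2) (nc i4) u24.
pose v := p i2 *m invmx A1.
have vA : v *m A1 = p i2 by rewrite mulmxKV // (unitary_unitmx hsig U1).
have nv : hnorm h v = 1 by rewrite -(unitary_nrm v U1) vA.
(* A1 fixes p_1 and carries p_4 to p_2 as points, so ta(p_1, p_4) = ta(p_1, p_2). *)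
have t14 : 1 < tance h (p i1) (p i4).
  rewrite (tau_same_point _ (nc i4) nv hp4).
  by rewrite -(fixes_tau v U1 (nc i1) hfix1.2) vA.
have t34 : 1 < tance h (p i3) (p i4).
  rewrite (tau_same_point _ (nc i4) nv hp4).
  have [l l1 p2A] := fixes_unit U2 (nc i2) hfix2.2.
  have /is_scalar_mxP[m M] := Msc.
  (* Evaluating v A1 A2 A3 in two ways identifies p_4 with the image of p_2 under A3, which fixes
     p_3; hence ta(p_3, p_4) = ta(p_3, p_2). *)
  have mv : m *: v = l *: (p i2 *m A3).
    by rewrite -mul_mx_scalar -M !mulmxA vA p2A scalemxAl.
  have nw : hnorm h (p i2 *m A3) = 1 by rewrite (unitary_nrm _ U3).
  have m1 : sqn m = 1.
    by have := congr1 (hnorm h) mv; rewrite !nrmZ nv nw l1 !mulr1.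
  have : sqn (h (p i3) (m *: v)) = tance h (p i3) v.
    by rewrite hZr sqnM sqn_conj m1 mul1r.
  by rewrite mv hZr sqnM sqn_conj l1 mul1r -/(tance h (p i3) _) (fixes_tau _ U3 (nc i3) hfix3.2) => <-.
have {T1} T1 := (triangle_condP hsig (nc i1) (nc i2) (nc i4) t12 t14 t24).1 T1.
have t42 : 1 < tance h (p i4) (p i2) by rewrite tauC.
have {T3} T3 := (triangle_condP hsig (nc i3) (nc i4) (nc i2) t34 t32 t42).1 T3.
have [f [nf fp2 fp4]] := common_polar hsig (nc i2) (nc i4) t24.
have all4 (P : 'I_4 -> Prop) : P i1 -> P i2 -> P i3 -> P i4 -> forall i, P i.
  move=> P1 P2 P3 P4 [[|[|[|[|//]]]] lt].
  - by rewrite (_ : Ordinal lt = i1) //; apply/val_inj.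
  - by rewrite (_ : Ordinal lt = i2) //; apply/val_inj.
  - by rewrite (_ : Ordinal lt = i3) //; apply/val_inj.
  - by rewrite (_ : Ordinal lt = i4) //; apply/val_inj.
have N1 : forall i, sqn (h (p i) f) < 1.
  apply: all4.
  - by case: T1 => V _ _ _; apply: polar_component_lt1 V.
  - by rewrite (h_eq0C fp2) /sqn /= expr0n addr0.
  - by case: T3 => V _ _ _; apply: polar_component_lt1 V.
  - by rewrite (h_eq0C fp4) /sqn /= expr0n addr0.
(* For i = 2, 4 the vector p_i is already orthogonal to f and stays put; only c_i and q_i move,
   until q_i = f. *)
have /choice[F FP] : forall i, exists F : (R -> vec R) * (R -> vec R) * (R -> vec R),
    [/\ [/\ continuous F.1.1, continuous F.1.2 & continuous F.2],
      [/\ F.1.1 0 = c i, F.1.2 0 = p i & F.2 0 = q i],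
      (forall d : R, 0 <= d <= 1 -> pos_orthonormal h k (F.1.1 d) (F.1.2 d) (F.2 d)),
      (forall d : R, 0 <= d <= 1 -> exists2 s : R, 1 <= s &
         forall u, h f u = 0 -> h (F.1.2 d) u = s%:C%C * h (p i) u) &
      [/\ (h (p i) f = 0 -> forall d, F.1.2 d = p i), h (F.1.2 1) f = 0 & F.2 1 = f]].
  move=> i; have [cc [pp [qq H]]] := frame_path hk (hbasis i) nf (N1 i).
  by exists (cc, pp, qq).
pose pp i := (F i).1.2.
have pp2 d : pp i2 d = p i2.
  by have [_ _ _ _ [H _ _]] := FP i2; exact: H (h_eq0C fp2) d.
have pp4 d : pp i4 d = p i4.
  by have [_ _ _ _ [H _ _]] := FP i4; exact: H (h_eq0C fp4) d.
have O d (d01 : 0 <= d <= 1) i : pos_orthonormal h k ((F i).1.1 d) (pp i d) ((F i).2 d).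
  by have [_ _ H _ _] := FP i; exact: H.
have n d (d01 : 0 <= d <= 1) i : hnorm h (pp i d) = 1.
  by case: (O d d01 i) => /orthonormal_nrm[].
have tau_ge i j d : 0 <= d <= 1 -> h f (p j) = 0 -> 1 < tance h (p i) (p j) ->
    1 < tance h (pp i d) (p j).
  move=> d01 fj t; have [_ _ _ /(_ d d01)[s s1 H] _] := FP i.
  rewrite (tau_scale (H _ fj)) (lt_le_trans t) // ler_peMl ?exprn_ege1 //.
  by rewrite (le_trans ler01) ?ltW.
have TC i j l d : 0 <= d <= 1 -> h f (p j) = 0 -> h f (p l) = 0 ->
    1 < tance h (p i) (p j) -> 1 < tance h (p i) (p l) -> 1 < tance h (p j) (p l) ->
    triangle_cond h (p i) (p j) (p l) -> triangle_cond h (pp i d) (p j) (p l).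
  move=> d01 fj fl tj tl tjl; have [_ _ _ /(_ d d01)[s s1 H] _] := FP i.
  exact: triangle_cond_scale (H _ fj) (H _ fl).
have S12 d : 0 <= d <= 1 -> 1 < tance h (pp i1 d) (p i2) by move=> ?; apply: tau_ge.
have S14 d : 0 <= d <= 1 -> 1 < tance h (pp i1 d) (p i4) by move=> ?; apply: tau_ge.
have S32 d : 0 <= d <= 1 -> 1 < tance h (pp i3 d) (p i2) by move=> ?; apply: tau_ge.
have S34 d : 0 <= d <= 1 -> 1 < tance h (pp i3 d) (p i4) by move=> ?; apply: tau_ge.
have T1d d : 0 <= d <= 1 -> triangle_cond h (pp i1 d) (p i2) (p i4).
  by move=> ?; apply: TC.
have T3d d : 0 <= d <= 1 -> triangle_cond h (pp i3 d) (p i4) (p i2).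
  by move=> ?; apply: TC.
have S13 d (d01 : 0 <= d <= 1) : 1 < tance h (pp i1 d) (pp i3 d).
  exact: (triangle_cond_separates hsig (n d d01 i1) (n d d01 i3) (nc i2) (nc i4)
    (S12 d d01) (S14 d d01) (S32 d d01) (S34 d d01) t24 (T1d d d01) (T3d d d01)).
exists (fun i => (F i).1.1), pp, (fun i => (F i).2); split.
- by move=> i; have [[c1 c2 c3] _ _ _ _] := FP i; split;
    [exact: (continuous_subspaceT c1)|exact: (continuous_subspaceT c2)
    |exact: (continuous_subspaceT c3)].
- by move=> i; have [_ H _ _ _] := FP i.
have f1 i : h f (pp i 1) = 0 by have [_ _ _ _ [_ /h_eq0C]] := FP i.
have q1 i : (F i).2 1 = f by have [_ _ _ _ []] := FP i.
have d1 : (0 <= (1 : R)) && ((1 : R) <= 1) by rewrite lexx ler01.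
split.
- by move=> i d d01; exact: O.
- move=> i j d ij d01.
  have -> : ta h (pp i d) (pp j d) = (tance h (pp i d) (pp j d))%:C%C.
    by rewrite /ta h_mul_tau !hxx !n // mulr1 divr1.
  rewrite cplx_gt1 eqxx /=.
  have [s12 s14 s32 s34] := And4 (S12 d d01) (S14 d d01) (S32 d d01) (S34 d d01).
  have s13 := S13 d d01.
  move: i j ij; apply: (all4 _); apply: (all4 _) => //= _; rewrite ?pp2 ?pp4 //;
    by rewrite tauC ?pp2 ?pp4.
- move=> d d01; rewrite pp2 pp4.
  have [A B] := (triangle_condP hsig (n d d01 i1) (nc i2) (nc i4) (S12 d d01)
    (S14 d d01) t24).2 (T1d d d01).
  have [A' B'] := (triangle_condP hsig (n d d01 i3) (nc i4) (nc i2) (S34 d d01)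
    (S32 d d01) t42).2 (T3d d d01).
  by [].
- by rewrite !q1.
(* At time 1 all four polar points are orthogonal to f, so f is the focus of each side. *)
- have f0 : 0 < hnorm h f by rewrite nf.
  exists f; split.
  + by apply: bisector_data_exists => //; rewrite ?n // pp2; exact: S12.
  + by apply: bisector_data_exists => //; rewrite ?n // pp2 tauC; exact: S32.
  + by apply: bisector_data_exists => //; rewrite ?n // pp4; exact: S34.
  + by apply: bisector_data_exists => //; rewrite ?n // pp4 tauC; exact: S14.
Qed.
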